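(* Let $E,F$ be Banach spaces and let $(\mathcal{T}(t))_{t\ge0}$ be a strongly continuous semigroup on $\mathcal{E}=E\times F$ with generator $\mathcal{A}$, of upper triangular form $$\mathcal{T}(t)=\begin{pmatrix}T(t)&R(t)\\0&S(t)\end{pmatrix}\quad\text{for all }t\ge0.$$ Let $A$ and $B$ be the generators of the semigroups $(T(t))_{t\ge0}$ on $E$ and $(S(t))_{t\ge0}$ on $F$, respectively, and let $\mathcal{D}=\begin{pmatrix}A&0\\0&B\end{pmatrix}$ with $D(\mathcal{D})=D(A)\times D(B)$. Then the following assertions are equivalent. (a) There exists $K>0$ such that $\|R(t)\|\le Kt$ for all $t\in[0,1]$. (a') There exist $K>0$, $\omega\in\mathbb{R}$ such that $\|R(t)\|\le Kt\cdot\mathrm{e}^{\omega t}$ for all $t\ge0$. (b) There exists $P\in\mathcal{L}(F,\mathrm{Fav}_0(A))$ such that $\mathcal{A}=(\mathcal{D}_{-1}+\mathcal{P})|_{\mathcal{E}}$, where $\mathcal{P}=\begin{pmatrix}0&P\\0&0\end{pmatrix}$. (c) For some (equivalently, for all) $\lambda\in\rho(\mathcal{D})$ there exists $D_\lambda\in\mathcal{L}(F,\mathrm{Fav}_1(A))$ such that $$\lambda-\mathcal{A}=(\lambda-\mathcal{D})\begin{pmatrix}\mathrm{Id}&-D_\lambda\\0&\mathrm{Id}\end{pmatrix}.$$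
   Context: For a semigroup $(T(t))_{t\ge0}$ with generator $A$ on a Banach space $E$, the Favard class is $\mathrm{Fav}_1(A):=\{x\in E:\sup_{t\in(0,1]}t^{-1}\|T(t)x-x\|<\infty\}$, a Banach space under $\|x\|_{\mathrm{Fav}_1(A)}:=\|x\|+\sup_{t\in(0,1]}t^{-1}\|T(t)x-x\|$. Extrapolation: $E_{-1}$ is the completion of $E$ for the norm $\|x\|_{-1}=\|R(\mu,A)x\|$ ($\mu\in\rho(A)$ fixed; different choices give equivalent norms); $T(t)$ extends continuously to a strongly continuous semigroup $(T_{-1}(t))_{t\ge0}$ on $E_{-1}$ with generator $A_{-1}$, $D(A_{-1})=E$. $F_{-1}$, $S_{-1}(t)$ and $B_{-1}$ are defined analogously from $F$, $S(t)$ and $B$. Put $\mathrm{Fav}_0(A):=\mathrm{Fav}_1(A_{-1})\subset E_{-1}$ (the Favard class of $(T_{-1}(t))_{t\ge0}$). $\mathcal{D}_{-1}=\begin{pmatrix}A_{-1}&0\\0&B_{-1}\end{pmatrix}$ with $D(\mathcal{D}_{-1})=D(A_{-1})\times D(B_{-1})=E\times F$, acting in $E_{-1}\times F_{-1}$; $\mathcal{P}$ maps $\binom{x}{y}\in E\times F$ to $\binom{Py}{0}\in E_{-1}\times F_{-1}$. For an operator $G:E\times F\to E_{-1}\times F_{-1}$, $G|_{\mathcal{E}}$ denotes the part of $G$ in $\mathcal{E}$: domain $\{z\in\mathcal{E}:Gz\in\mathcal{E}\}$ and action $z\mapsto Gz$. Identities between unbounded operators include equality of domains, products having their natural (maximal)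 domain. *)

(* Defs.v *)
From HB Require Import structures.
From mathcomp Require Import all_boot all_order all_algebra.
From mathcomp Require Import complex.
From mathcomp Require Import all_classical all_reals all_analysis.

Set Implicit Arguments.
Unset Strict Implicit.
Unset Printing Implicit Defensive.

Import Order.TTheory GRing.Theory Num.Theory.
Import numFieldNormedType.Exports.

Local Open Scope classical_set_scope.
Local Open Scope ring_scope.

(* Banach spaces may be real or complex.  Norms of a normedModType K are
   K-valued, so [of_real] and [to_real] are used to move between the
   (real) time parameter and bounds on the one side, and K on the other. *)
Inductive scalars (R : realType) : numFieldType -> Type :=
| real_scalars : scalars R R
| complex_scalars : scalars R R[i].

Definition of_real (R : realType) (K : numFieldType) (s : scalars R K) :
    R -> K :=
  match s in scalars _ K0 return R -> K0 with
  | real_scalars => fun t => t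
  | complex_scalars => fun t => t%:C%C
  end.

(* The real part; only ever applied to norms, which are real. *)
Definition to_real (R : realType) (K : numFieldType) (s : scalars R K) :
    K -> R :=
  match s in scalars _ K0 return K0 -> R with
  | real_scalars => fun z => z
  | complex_scalars => fun z => complex.Re z
  end.

Definition nrm (R : realType) (K : numFieldType) (s : scalars R K)
    (E : normedModType K) (x : E) : R :=
  to_real s `|x|.

Definition bounded_op (K : numFieldType) (E F : normedModType K)
    (f : E -> F) : Prop :=
  linear f /\ continuous f.

Definition opnorm (R : realType) (K : numFieldType) (s : scalars R K)
    (E F : normedModType K) (f : E -> F) : R :=
  sup [set nrm s (f x) | x in [set x | nrm s x <= 1]].

(** Operators with a domain; values outside of [dom] are irrelevant. *)

Record operator (U V : Type) := Operator { dom : set U; app :> U -> V }.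

Definition op_eq (U V : Type) (G H : operator U V) : Prop :=
  dom G = dom H /\ forall x, dom G x -> G x = H x.

Definition op_total (U V : Type) (f : U -> V) : operator U V :=
  Operator setT f.

Definition op_add (U : Type) (V : zmodType) (G H : operator U V) :
    operator U V :=
  Operator (dom G `&` dom H) (fun x => G x + H x).

Definition op_comp (U V W : Type) (G : operator V W) (H : operator U V) :
    operator U W :=
  Operator [set x | dom H x /\ dom G (H x)] (fun x => G (H x)).

Definition op_shift (K : numFieldType) (E : lmodType K) (lambda : K)
    (G : operator E E) : operator E E :=
  Operator (dom G) (fun x => lambda *: x - G x).

Definition op_diag (U V : Type) (G : operator U U) (H : operator V V) :
    operator (U * V) (U * V) :=
  Operator (dom G `*` dom H) (fun z => (G z.1, H z.2)).

(* The part in U of an operator from U to W, where U is regarded as a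
   subspace of W through the (injective) map [j]. *)
Definition op_part (U : choiceType) (W : Type) (j : U -> W) (G : operator U W) :
    operator U U :=
  Operator [set z | dom G z /\ range j (G z)]
           (fun z => xget z [set w | j w = G z]).

(* The function (lambda - G)^-1, extended by 0 where it is not defined. *)
Definition resolvent (K : numFieldType) (E : normedModType K)
    (G : operator E E) (lambda : K) (x : E) : E :=
  xget 0 [set y | dom G y /\ op_shift lambda G y = x].

Definition resolvent_set (K : numFieldType) (E : normedModType K)
    (G : operator E E) : set K :=
  [set lambda | set_bij (dom G) setT (op_shift lambda G)
                /\ bounded_op (resolvent G lambda)].

(** Families indexed by R are only relevant at times t >= 0. *)

Definition C0_semigroup (R : realType) (K : numFieldType)
    (E : normedModType K) (T : R -> E -> E) : Prop :=
  [/\ forall t, 0 <= t -> bounded_op (T t),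
      forall x, T 0 x = x,
      forall t r, 0 <= t -> 0 <= r -> forall x, T (t + r) x = T t (T r x)
    & forall x, {within `[0, +oo[, continuous (fun t => T t x)}].

Definition generator (R : realType) (K : numFieldType) (s : scalars R K)
    (E : normedModType K) (T : R -> E -> E) : operator E E :=
  let quotient x t := (of_real s t)^-1 *: (T t x - x) in
  Operator [set x | cvg (quotient x t @[t --> 0^'+])]
           (fun x => lim (quotient x t @[t --> 0^'+])).

Definition favard_quotients (R : realType) (K : numFieldType)
    (s : scalars R K) (E : normedModType K) (T : R -> E -> E) (x : E) :
    set R :=
  [set t^-1 * nrm s (T t x - x) | t in `]0, 1]].

(* Fav_1 of the generator of T. *)
Definition favard (R : realType) (K : numFieldType) (s : scalars R K)
    (E : normedModType K) (T : R -> E -> E) : set E :=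
  [set x | has_ubound (favard_quotients s T x)].

Definition favard_norm (R : realType) (K : numFieldType) (s : scalars R K)
    (E : normedModType K) (T : R -> E -> E) (x : E) : R :=
  nrm s x + sup (favard_quotients s T x).

(* P belongs to L(F, Fav_1), Fav_1 being endowed with its own norm. *)
Definition bounded_to_favard (R : realType) (K : numFieldType)
    (s : scalars R K) (F E : normedModType K) (T : R -> E -> E)
    (P : F -> E) : Prop :=
  [/\ linear P,
      forall y, favard s T (P y)
    & exists C : R, forall y, favard_norm s T (P y) <= C * nrm s y].

(* The extrapolation space E_{-1} with its semigroup T_{-1}.  A completion of
   (E, |R(mu, A) _|) is a Banach space together with a linear map from E which
   is isometric for this norm and has dense range. *)
Record extrapolation (R : realType) (K : numFieldType) (s : scalars R K)
    (E : normedModType K) (T : R -> E -> E) := Extrapolation {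
  ext_mu : K;
  ext_space : completeNormedModType K;
  ext_emb : {linear E -> ext_space};
  ext_sg : R -> ext_space -> ext_space;
  ext_muP : resolvent_set (generator s T) ext_mu;
  ext_norm : forall x,
    `|ext_emb x| = `|resolvent (generator s T) ext_mu x|;
  ext_dense : dense (range ext_emb);
  ext_sg_continuous : forall t, 0 <= t -> continuous (ext_sg t);
  ext_sgE : forall t, 0 <= t ->
    forall x, ext_sg t (ext_emb x) = ext_emb (T t x) }.

Arguments ext_sg {R K s E T} e t x : rename.

Section Assertions.
Context (R : realType) (K : numFieldType) (s : scalars R K).
Context (E F : normedModType K).

(* (A_{-1} (+) B_{-1} + calP) restricted to E * F, where
   calP (x, y) = (P y, 0). *)
Definition perturbed_part (T : R -> E -> E) (S : R -> F -> F)
    (XE : extrapolation s T) (XF : extrapolation s S)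
    (P : F -> ext_space XE) : operator (E * F) (E * F) :=
  let j (z : E * F) := (ext_emb XE z.1, ext_emb XF z.2) in
  let D1 := op_diag (generator s (ext_sg XE)) (generator s (ext_sg XF)) in
  op_part j (op_add (op_comp D1 (op_total j))
                    (op_total (fun z => (P z.2, 0)))).

Definition extrapolated_form (A : operator (E * F) (E * F))
    (T : R -> E -> E) (S : R -> F -> F)
    (XE : extrapolation s T) (XF : extrapolation s S) : Prop :=
  exists P : F -> ext_space XE,
    bounded_to_favard s (ext_sg XE) P /\ op_eq A (perturbed_part XF P).

Definition factorized_form (A D : operator (E * F) (E * F))
    (T : R -> E -> E) (lambda : K) : Prop :=
  exists Dl : F -> E,
    bounded_to_favard s T Dl /\
    op_eq (op_shift lambda A)
          (op_comp (op_shift lambda D)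
                   (op_total (fun z : E * F => (z.1 - Dl z.2, z.2)))).

End Assertions.

(* Main.v *)
Require Import Defs.
From HB Require Import structures.
From mathcomp Require Import all_boot all_order all_algebra.
From mathcomp Require Import complex.
From mathcomp Require Import all_classical all_reals all_analysis.
From mathcomp Require Import ring lra.

Set Implicit Arguments.
Unset Strict Implicit.
Unset Printing Implicit Defensive.

Import Order.TTheory GRing.Theory Num.Theory.
Import numFieldNormedType.Exports.

Local Open Scope classical_set_scope.
Local Open Scope ring_scope.

(** Write A, B and calA for the generators of T, S and calT, and mu for the
    point of the resolvent set of A that defines E_{-1}. The assertions are
    compared through one relation, [factors l D]: the graph of calA consists
    of the (x, y), (u, v) such that (y, v) is in the graph of B and (x - Dy, u
    - l Dy) in that of A. This is assertion (c) at l ([factorized_formP]), and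
    for l = mu it is also assertion (b) ([extrapolated_formP]): by
    construction of E_{-1}, mu - A_{-1} is an isometry of E onto E_{-1} that
    intertwines T(t) and T_{-1}(t) ([ext_iso_exists]), hence maps Fav_1(A)
    onto Fav_0(A), and P and D correspond to each other by P = (mu - A_{-1})D.

    It remains to see that, for any l in the resolvent set of A, assertion (a)
    is equivalent to the existence of a bounded D from F to Fav_1(A) with
    [factors l D].

    If ||R(t)|| <= Mt, then R(h)/h stays bounded and Dy = lim R(l, A)R(h)y / h
    exists for y in the domain of B, because there the orbits of calT are
    differentiable; it exists on all of F by density
    ([corner_lipschitz_factors]). Here each y in the domain of B must be
    completed to a point (x, y) of the domain of calA, and this uses a common
    point of the resolvent sets of calA and B.

    Conversely, for y in the domain of B the pair (Dy, y) is in the domain of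
    calA with image (l Dy, By), whence ||R(h)y|| <= c||y||h + o(h) by the
    Favard estimate. Since R(t + h) = T(t)R(h) + R(t)S(h), a mean value
    inequality along s |-> T(t - s)R(s)y turns this into ||R(t)|| <= Mt
    ([factors_corner_lipschitz]).

    From the general theory of semigroups only a few facts are used: the
    domain of a generator is dense, its resolvent set contains all large real
    numbers, and orbits are locally bounded uniformly on the unit ball. They
    are derived from the integral of an orbit over [0, r], constructed as a
    limit of Riemann sums over dyadic subdivisions ([orbit_integral_deriv],
    [large_resolvent_point]), and from the uniform boundedness principle. Real
    and complex scalars are treated at once by working with real-valued norms.
    *)

(** * Linear identities in modules *)

Section ModuleIdentities.
Context (K : numFieldType) (E : lmodType K).

Inductive mexpr :=
| MAtom of nat | MZero | MAdd of mexpr & mexpr | MOpp of mexpr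
| MScale of K & mexpr.

Fixpoint meval (l : seq E) (e : mexpr) : E :=
  match e with
  | MAtom i => nth 0 l i
  | MZero => 0
  | MAdd e1 e2 => meval l e1 + meval l e2
  | MOpp e1 => - meval l e1
  | MScale c e1 => c *: meval l e1
  end.

Fixpoint mcoef (i : nat) (e : mexpr) : K :=
  match e with
  | MAtom j => if eqn i j then 1 else 0
  | MZero => 0
  | MAdd e1 e2 => mcoef i e1 + mcoef i e2
  | MOpp e1 => - mcoef i e1
  | MScale c e1 => c * mcoef i e1
  end.

Fixpoint same_coefs (n : nat) (e1 e2 : mexpr) : Prop :=
  if n is m.+1 then mcoef m e1 = mcoef m e2 /\ same_coefs m e1 e2 else True.

Lemma meval_coefs l e : meval l e = \sum_(i < size l) mcoef i e *: nth 0 l i.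
Proof.
elim: e => [j||e1 IH1 e2 IH2|e1 IH1|c e1 IH1] /=.
- have mcE i : (if eqn i j then 1 else 0 : K) = (i == j)%:R.
    by rewrite eqnE; case: eqP.
  have [jl|lj] := ltnP j (size l).
    rewrite (bigD1 (Ordinal jl)) //= mcE eqxx scale1r big1 ?addr0 // => i ij.
    by rewrite mcE (_ : _ == j = false) ?scale0r //; apply: negbTE ij.
  rewrite nth_default // big1 // => i _.
  by rewrite mcE ltn_eqF ?scale0r // (leq_trans (ltn_ord i)).
- by rewrite big1 // => i _; rewrite scale0r.
- by rewrite IH1 IH2 -big_split /=; apply: eq_bigr => i _; rewrite scalerDl.
- by rewrite IH1 -sumrN; apply: eq_bigr => i _; rewrite scaleNr.
- by rewrite IH1 scaler_sumr; apply: eq_bigr => i _; rewrite scalerA.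
Qed.

(** Both sides are linear combinations of the same atoms, so an identity in a
    module is reduced to identities between scalars. *)
Lemma module_identity l e1 e2 :
  same_coefs (size l) e1 e2 -> meval l e1 = meval l e2.
Proof.
move=> h; rewrite !meval_coefs; apply: eq_bigr => i _; congr (_ *: _).
elim: (size l) i h => [[]//|n IH i /= [hn h]].
have := ltn_ord i; rewrite ltnS leq_eqVlt => /predU1P[->//|ilt].
exact: (IH (Ordinal ilt)).
Qed.

End ModuleIdentities.

Ltac atom_index x l :=
  lazymatch l with
  | x :: _ => constr:(O)
  | _ :: ?l' => let n := atom_index x l' in constr:(S n)
  end.

Ltac add_atom x l :=
  let rec mem l' := lazymatch l' with
    | nil => constr:(x :: l)
    | x :: _ => l
    | _ :: ?l'' => mem l''
    end in mem l.

Ltac atoms_of t l :=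
  lazymatch t with
  | GRing.add ?a ?b => let l1 := atoms_of a l in atoms_of b l1
  | GRing.opp ?a => atoms_of a l
  | GRing.scale _ ?a => atoms_of a l
  | GRing.zero => l
  | _ => add_atom t l
  end.

Ltac reify_module K t l :=
  lazymatch t with
  | GRing.add ?a ?b =>
    let a' := reify_module K a l in let b' := reify_module K b l in
    constr:(MAdd a' b')
  | GRing.opp ?a => let a' := reify_module K a l in constr:(MOpp a')
  | GRing.scale ?c ?a => let a' := reify_module K a l in constr:(MScale c a')
  | GRing.zero => constr:(@MZero K)
  | _ => let n := atom_index t l in constr:(@MAtom K n)
  end.

(** Atoms are compared up to syntactic equality only; a coefficient identity
    that [ring] does not solve is left as a goal. *)
Ltac module_eq K :=
  lazymatch goal with
  | |- @eq ?T ?a ?b =>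
    let l0 := atoms_of a (@nil T) in
    let l := atoms_of b l0 in
    let ea := reify_module K a l in
    let eb := reify_module K b l in
    apply: (@module_identity K _ l ea eb);
    rewrite /=; do ?split=> //; try ring
  end.

(** * Real-valued norms *)

Lemma le_eps (R : realType) (x y : R) :
  (forall e : R, 0 < e -> x <= y + e) -> x <= y.
Proof. by move=> h; apply/ler_addgt0Pr => e /h. Qed.

Section RealNorm.
Context (R : realType) (K : numFieldType) (s : scalars R K).

Let of_real_zmod_morphism : zmod_morphism (of_real s).
Proof. by case: K / s => //= x y; rewrite rmorphB. Qed.

Let of_real_monoid_morphism : monoid_morphism (of_real s).
Proof. by case: K / s => //=; split=> [|x y]; rewrite ?rmorph1 ?rmorphM. Qed.

HB.instance Definition _ :=
  GRing.isZmodMorphism.Build R K (of_real s) of_real_zmod_morphism.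
HB.instance Definition _ :=
  GRing.isMonoidMorphism.Build R K (of_real s) of_real_monoid_morphism.

Lemma ler_of_real x y : (of_real s x <= of_real s y) = (x <= y).
Proof. by case: K / s => //=; rewrite lecR. Qed.

Lemma ltr_of_real x y : (of_real s x < of_real s y) = (x < y).
Proof. by case: K / s => //=; rewrite ltcR. Qed.

Lemma of_real_norm x : `|of_real s x| = of_real s `|x|.
Proof. by case: K / s => //=; rewrite normc_def /= expr0n addr0 sqrtr_sqr. Qed.

(** Comparison with 0 in the complex numbers forces the imaginary part to
    vanish, so that no information is lost on norms. *)
Lemma of_real_ge0 z : 0 <= z -> of_real s (to_real s z) = z.
Proof.
case: K / s z => //= z z0; apply/eqP; rewrite eq_complex /= eqxx /=.
by case: z z0 => a b; rewrite lecE /= => /andP[/eqP ->].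
Qed.

Lemma to_realK x : to_real s (of_real s x) = x.
Proof. by case: K / s. Qed.

Definition absK (a : K) : R := to_real s `|a|.

Lemma of_absK a : of_real s (absK a) = `|a|.
Proof. exact: of_real_ge0. Qed.

Lemma absK_ge0 a : 0 <= absK a.
Proof. by rewrite -ler_of_real rmorph0 of_absK. Qed.

Lemma absK_of_real x : absK (of_real s x) = `|x|.
Proof. by rewrite /absK of_real_norm to_realK. Qed.

Section Space.
Context (E : normedModType K).
Implicit Types x y : E.

Lemma of_nrm x : of_real s (nrm s x) = `|x|.
Proof. exact: of_real_ge0. Qed.

Lemma nrm_ge0 x : 0 <= nrm s x.
Proof. by rewrite -ler_of_real rmorph0 of_nrm. Qed.

Lemma nrm_eq0 x : nrm s x = 0 -> x = 0.
Proof.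
by move=> x0; apply/eqP; rewrite -normr_eq0 -of_nrm x0 rmorph0.
Qed.

Lemma nrm0 : nrm s (0 : E) = 0.
Proof. by rewrite -[RHS]to_realK rmorph0 /nrm normr0. Qed.

Lemma nrmN x : nrm s (- x) = nrm s x.
Proof. by rewrite /nrm normrN. Qed.

Lemma nrmBC x y : nrm s (x - y) = nrm s (y - x).
Proof. by rewrite -nrmN opprB. Qed.

Lemma nrmD x y : nrm s (x + y) <= nrm s x + nrm s y.
Proof. by rewrite -ler_of_real rmorphD /= !of_nrm ler_normD. Qed.

Lemma nrmZ a x : nrm s (a *: x) = absK a * nrm s x.
Proof.
by rewrite -[LHS]to_realK of_nrm normrZ -of_nrm -of_absK -rmorphM to_realK.
Qed.

Lemma nrmZr t x : 0 <= t -> nrm s (of_real s t *: x) = t * nrm s x.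
Proof. by move=> t0; rewrite nrmZ absK_of_real ger0_norm. Qed.

Lemma nrm_le0 x : (forall e : R, 0 < e -> nrm s x <= e) -> x = 0.
Proof.
move=> h; apply: nrm_eq0; apply/eqP; rewrite eq_le nrm_ge0 andbT.
by apply: le_eps => e e0; rewrite add0r h.
Qed.

Lemma nrm_split a b x y z : z = x + y -> nrm s x <= a -> nrm s y <= b ->
  nrm s z <= a + b.
Proof. by move=> -> xa yb; apply: le_trans (nrmD _ _) _; apply: lerD. Qed.

Lemma nrm_dist x y : `|nrm s x - nrm s y| <= nrm s (x - y).
Proof.
have hx := nrmD (x - y) y; have hy := nrmD (y - x) x.
rewrite subrK in hx; rewrite subrK nrmBC in hy.
by rewrite ler_norml; apply/andP; split; lra.
Qed.

(** The decomposition of [z] comes last, because [x] and [y] are known from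
    the two estimates once these are given. *)
Lemma nrm_le2 a b x y z : nrm s x <= a -> nrm s y <= b -> z = x + y ->
  nrm s z <= a + b.
Proof. by move=> xa yb zE; apply: nrm_split zE xa yb. Qed.

Lemma nrm_le2B a b x y z : nrm s x <= a -> nrm s y <= b -> z = x - y ->
  nrm s z <= a + b.
Proof. by move=> xa yb; apply: nrm_le2 xa _; rewrite nrmN. Qed.

(** Every positive scalar is the image of a positive real, so balls with real
    radii form a basis of neighbourhoods. *)
Lemma nbhs_nrmP x (P : set E) :
  nbhs x P <-> exists2 e : R, 0 < e & forall y, nrm s (y - x) < e -> P y.
Proof.
split.
  move=> /nbhs_normP[e /= e0 he]; exists (to_real s e).
    by rewrite -ltr_of_real rmorph0 of_real_ge0 // ltW.
  move=> y; rewrite -ltr_of_real of_nrm of_real_ge0 ?(ltW e0) // => ye.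
  by apply: he; rewrite /= distrC.
move=> [e e0 he]; apply/nbhs_normP; exists (of_real s e) => /=.
  by rewrite -[0](rmorph0 (of_real s)) ltr_of_real.
by move=> y /=; rewrite distrC -of_nrm ltr_of_real => /he.
Qed.

Lemma cvg_nrmP (I : Type) (F : set_system I) (FF : Filter F) (f : I -> E) l :
  f @ F --> l <-> forall e : R, 0 < e -> \forall i \near F, nrm s (f i - l) < e.
Proof.
split.
  move=> fl e e0; apply: (fl [set y | nrm s (y - l) < e]).
  by apply/nbhs_nrmP; exists e.
move=> fl P /nbhs_nrmP[e e0 he]; apply: filterS (fl e e0) => i; exact: he.
Qed.

End Space.

Lemma nrm_pair (E F : normedModType K) (x : E) (y : F) :
  nrm s ((x, y) : E * F) = Num.max (nrm s x) (nrm s y).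
Proof.
rewrite -[LHS]to_realK of_nrm prod_normE /= -!of_nrm.
have [h|h] := leP (nrm s x) (nrm s y).
  by rewrite max_r ?ler_of_real // to_realK.
by rewrite max_l ?ler_of_real ?to_realK // ltW.
Qed.

End RealNorm.

(** * Bounded operators and completeness *)

Section Linear.
Context (K : numFieldType) (E F : lmodType K) (f : E -> F).
Hypothesis linf : linear f.

Lemma lin0 : f 0 = 0.
Proof. by have := linf (-1) 0 0; rewrite scaler0 add0r scaleN1r addNr. Qed.

Lemma linZ a x : f (a *: x) = a *: f x.
Proof. by have := linf a x 0; rewrite lin0 !addr0. Qed.

Lemma linD x y : f (x + y) = f x + f y.
Proof. by have := linf 1 x y; rewrite !scale1r. Qed.

Lemma linN x : f (- x) = - f x.
Proof. by rewrite -scaleN1r linZ scaleN1r. Qed.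

Lemma linB x y : f (x - y) = f x - f y.
Proof. by rewrite linD linN. Qed.

Lemma lin_sum n (g : nat -> E) :
  f (\sum_(0 <= i < n) g i) = \sum_(0 <= i < n) f (g i).
Proof. exact: (big_morph f linD lin0). Qed.

End Linear.

Section BoundedOperators.
Context (R : realType) (K : numFieldType) (s : scalars R K).

Lemma bounded_opP (E F : normedModType K) (f : E -> F) :
  bounded_op f <->
  linear f /\ exists2 C, 0 < C & forall x, nrm s (f x) <= C * nrm s x.
Proof.
split=> -[linf].
  move=> cf; split=> //.
  have /nbhs_nrmP - /(_ R s)[d d0 hd] :
      nbhs (0 : E) (f @^-1` [set y | nrm s (y - f 0) < 1]).
    by apply: cf; apply/(nbhs_nrmP s); exists 1.
  exists (2 / d); first by rewrite divr_gt0.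
  move=> x; have [x0|x0] := eqVneq (nrm s x) 0.
    by rewrite (nrm_eq0 x0) (lin0 linf) !nrm0 mulr0.
  have {}x0 : 0 < nrm s x by rewrite lt_def x0 nrm_ge0.
  pose c := d / (2 * nrm s x).
  have c0 : 0 < c by rewrite divr_gt0 // mulr_gt0.
  have cx : nrm s (of_real s c *: x) < d.
    by rewrite nrmZr ?(ltW c0) // /c; move: d0 x0; set n := nrm s x => d0 x0;
       rewrite (_ : d / (2 * n) * n = d / 2); [lra | field; rewrite gt_eqF].
  have := hd (of_real s c *: x); rewrite subr0 => /(_ cx) /=.
  rewrite (lin0 linf) subr0 (linZ linf) nrmZr ?(ltW c0) // => h.
  rewrite -(ler_pM2l c0); apply/ltW/(lt_le_trans h).
  rewrite (_ : c * _ = 1) // /c; move: d0 x0; set n := nrm s x => d0 x0; field.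
  by rewrite !gt_eqF.
move=> [C C0 hC]; split=> // x; apply/(cvg_nrmP s) => e e0.
apply/(nbhs_nrmP s); exists (e / C); first by rewrite divr_gt0.
move=> y; rewrite ltr_pdivlMr // mulrC -(linB linf); exact: le_lt_trans.
Qed.

Lemma opnorm_leP (E F : normedModType K) (f : E -> F) M :
  bounded_op f -> 0 <= M ->
  opnorm s f <= M <-> forall x, nrm s (f x) <= M * nrm s x.
Proof.
move=> /bounded_opP - [linf [C C0 hC]] M0; split; last first.
  move=> h; apply: ge_sup; first by exists (nrm s (f 0)), 0 => //=; rewrite nrm0.
  move=> _ [x /= x1 <-]; apply: le_trans (h x) _.
  by rewrite -[leRHS]mulr1 ler_wpM2l.
move=> hM x; have [x0|x0] := eqVneq (nrm s x) 0.
  by rewrite (nrm_eq0 x0) (lin0 linf) !nrm0 mulr0.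
have {}x0 : 0 < nrm s x by rewrite lt_def x0 nrm_ge0.
rewrite -ler_pdivrMr // mulrC -nrmZr ?invr_ge0 ?nrm_ge0 // -(linZ linf).
apply: le_trans hM; apply: ub_le_sup.
  exists C => _ [y /= y1 <-]; apply: le_trans (hC y) _.
  by rewrite -[leRHS]mulr1 ler_pM2l.
exists (of_real s (nrm s x)^-1 *: x) => //=.
by rewrite nrmZr ?invr_ge0 ?nrm_ge0 // mulVf // gt_eqF.
Qed.

(** Completeness in a form without filters: [Phi e x] means that [x] is an
    approximation, up to [e], of the point to be constructed.  Integrals and
    extensions by density are both obtained in this way, and the property
    passes to products. *)
Definition approx_complete (E : normedModType K) := forall Phi : R -> E -> Prop,
  (forall e : R, 0 < e -> exists x, Phi e x) ->
  (forall (e e' : R) x x', 0 < e -> 0 < e' -> Phi e x -> Phi e' x' ->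
     nrm s (x - x') <= e + e') ->
  exists x, forall (e : R) x', 0 < e -> Phi e x' -> nrm s (x' - x) <= e.

Lemma complete_approx (E : completeNormedModType K) : approx_complete E.
Proof.
move=> Phi ex cauchyP.
pose B (e : R) := [set x | exists2 d : R, 0 < d <= e & Phi d x].
pose G := filter_from [set e : R | 0 < e] B.
have GF : ProperFilter G.
  apply: filter_from_proper; last first.
    by move=> e e0; have [x Px] := ex e e0; exists x, e; rewrite ?e0 /=.
  apply: filter_from_filter; first by exists 1 => /=.
  move=> a b a0 b0; exists (Num.min a b); first by rewrite /= lt_min a0.
  by move=> x [d]; rewrite le_min => /and3P[d0 da db] Px; split; exists d => //;
     rewrite d0.
have cG : cauchy G.
  apply: cauchy_exP => e e0.
  have er0 : 0 < to_real s e.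
    by rewrite -(ltr_of_real s) rmorph0 of_real_ge0 // ltW.
  have [x Px] := ex _ (divr_gt0 er0 (ltr0n _ 4)).
  exists x; exists (to_real s e / 4); first by rewrite /= divr_gt0.
  move=> y [d /andP[d0 de] Py]; rewrite -ball_normE /= -(of_nrm s).
  rewrite -[e](of_real_ge0 s (ltW e0)) ltr_of_real.
  by apply: le_lt_trans (cauchyP _ _ _ _ _ d0 Px Py) _; lra.
exists (lim G) => e x e0 Px; apply: le_eps => h h0.
have : \forall y \near G, nrm s (y - lim G) < h / 2.
  have cvG : G --> lim G by apply: cauchy_cvg.
  have [cvgGe _] := @cvg_nrmP _ _ s _ _ G _ id (lim G).
  by apply: cvgGe => //; rewrite divr_gt0.
move=> [d /= d0 hd].
have m0 : 0 < Num.min d (h / 2) by rewrite lt_min d0 divr_gt0.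
have [y Py] := ex _ m0.
have Bdy : B d y by exists (Num.min d (h / 2)); rewrite ?m0 /= ?ge_min ?lexx.
rewrite (_ : e + h = (e + h / 2) + h / 2); last by lra.
apply: (@nrm_split _ _ _ _ _ _ (x - y) (y - lim G)).
- by module_eq K.
- apply: le_trans (cauchyP _ _ _ _ e0 m0 Px Py) _.
  by rewrite lerD2l ge_min lexx orbT.
- exact/ltW/hd.
Qed.

Lemma approx_complete_prod (E F : normedModType K) :
  approx_complete E -> approx_complete F -> approx_complete (E * F)%type.
Proof.
move=> cE cF Phi ex cauchyP.
have [||x hx] := cE (fun e x => exists y, Phi e (x, y)).
- by move=> e e0; have [[x y] Pxy] := ex e e0; exists x, y.
- move=> e e' x x' e0 e'0 [y Py] [y' Py'].
  have := cauchyP _ _ _ _ e0 e'0 Py Py'.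
  by rewrite nrm_pair ge_max => /andP[].
have [||y hy] := cF (fun e y => exists x, Phi e (x, y)).
- by move=> e e0; have [[x0 y] Pxy] := ex e e0; exists y, x0.
- move=> e e' y y' e0 e'0 [x0 Px] [x' Px'].
  have := cauchyP _ _ _ _ e0 e'0 Px Px'.
  by rewrite nrm_pair ge_max => /andP[].
exists (x, y) => e [x' y'] e0 P'; rewrite nrm_pair ge_max /=.
by rewrite hx ?hy //; [exists x' | exists y'].
Qed.

(** Banach-Steinhaus for real and complex scalars at once, by nested balls.
    If the family is unbounded, every ball contains a smaller one on which some
    member exceeds [n]: one of [f (p + z)] and [f (p - z)] is at least as large
    as [f z].  A common point of these balls contradicts the pointwise bound. *)
Lemma uniform_boundedness (E F : normedModType K) (I : Type)
    (D : set I) (f : I -> E -> F) :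
  approx_complete E ->
  (forall i, D i -> bounded_op (f i)) ->
  (forall x, exists M, forall i, D i -> nrm s (f i x) <= M) ->
  exists2 M, 1 <= M & forall i x, D i -> nrm s (f i x) <= M * nrm s x.
Proof.
move=> cE fb pb; apply: contrapT => unb.
have step (p : E * R) (n : nat) : exists q : E * R, 0 < p.2 ->
    [/\ 0 < q.2, q.2 <= p.2 / 2,
        forall y, nrm s (y - q.1) <= q.2 -> nrm s (y - p.1) <= p.2
      & exists2 i, D i &
          forall y, nrm s (y - q.1) <= q.2 -> n%:R <= nrm s (f i y)].
  have [p0|] := ltP 0 p.2; last by exists p.
  (* With this M, a vector x violating the bound M, once rescaled to the norm
     p.2 / 2, is sent beyond n + 1. *)
  pose M := 1 + 2 * (n%:R + 1) / p.2.
  have M0 : 1 <= M by rewrite lerDl divr_ge0 ?mulr_ge0 ?addr_ge0 // ltW.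
  have [i [x [Di hx]]] : exists i x, D i /\ M * nrm s x < nrm s (f i x).
    apply: contrapT => h; apply: unb; exists M => // i x Di.
    rewrite leNgt; apply/negP => h'; apply: h.
    by exists i, x.
  have /bounded_opP - [linf [C C0 hC]] := fb i Di.
  have x0 : 0 < nrm s x.
    rewrite lt_def nrm_ge0 andbT; apply/eqP => /nrm_eq0 x0.
    by move: hx; rewrite x0 (lin0 linf) !nrm0 mulr0 ltxx.
  pose c := p.2 / (2 * nrm s x).
  have c0 : 0 < c by rewrite divr_gt0 // mulr_gt0.
  pose z := of_real s c *: x.
  have zn : nrm s z = p.2 / 2.
    by rewrite nrmZr ?(ltW c0) // /c; move: x0; set w := nrm s x => x0; field;
      rewrite gt_eqF.
  have fz : n%:R + 1 <= nrm s (f i z).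
    have : c * (M * nrm s x) <= nrm s (f i z).
      by rewrite (linZ linf) nrmZr ?(ltW c0) // ler_wpM2l // ltW.
    apply: le_trans; rewrite /c /M.
    move: x0 p0; set w := nrm s x; set r := p.2 => w0 r0.
    rewrite (_ : _ * _ = n%:R + 1 + r / 2); last by field; rewrite !gt_eqF.
    by rewrite lerDl divr_ge0 // ltW.
  have [q [qp fq]] : exists q, nrm s (q - p.1) = p.2 / 2 /\
      n%:R + 1 <= nrm s (f i q).
    have [h|h] := leP (n%:R + 1) (nrm s (f i (p.1 + z))).
      by exists (p.1 + z); split=> //; rewrite addrC addKr.
    exists (p.1 - z); split; first by rewrite addrC addKr nrmN.
    have : nrm s (f i z + f i z) <=
        nrm s (f i (p.1 + z)) + nrm s (f i (p.1 - z)).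
      apply: (@nrm_split _ _ _ _ _ _ (f i (p.1 + z)) (- f i (p.1 - z))).
      - by rewrite (linD linf) (linB linf); module_eq K.
      - by [].
      - by rewrite nrmN.
    have -> : f i z + f i z = of_real s 2 *: f i z.
      by rewrite rmorph_nat; module_eq K.
    by rewrite nrmZr //; lra.
  (* On the ball of radius 1 / C about q the operator varies by at most 1. *)
  pose r := Num.min (p.2 / 2) C^-1.
  have r0 : 0 < r by rewrite lt_min divr_gt0 // invr_gt0.
  exists (q, r) => _; split=> //=.
  - by rewrite ge_min lexx.
  - move=> y yq; have -> : p.2 = p.2 / 2 + p.2 / 2 by lra.
    apply: (@nrm_split _ _ _ _ _ _ (y - q) (q - p.1)).
    + by module_eq K.
    + by apply: le_trans yq _; rewrite ge_min lexx.
    + by rewrite qp.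
  - exists i => // y yq.
    have : nrm s (f i q) <= nrm s (f i y) + 1.
      apply: (@nrm_split _ _ _ _ _ _ (f i y) (f i (q - y))) => //.
        by rewrite (linB linf); module_eq K.
      apply: le_trans (hC _) _; rewrite -ler_pdivlMl // mulr1 nrmBC.
      by apply: le_trans yq _; rewrite ge_min lexx orbT.
    lra.
have /choice[g hg] : forall pn : (E * R) * nat, exists q : E * R, 0 < pn.1.2 ->
    [/\ 0 < q.2, q.2 <= pn.1.2 / 2,
        forall y, nrm s (y - q.1) <= q.2 -> nrm s (y - pn.1.1) <= pn.1.2
      & exists2 i, D i &
          forall y, nrm s (y - q.1) <= q.2 -> pn.2%:R <= nrm s (f i y)].
  by move=> [p n]; apply: step.
pose fix st n : E * R := if n is m.+1 then g (st m, m) else (0, 1).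
have st0 n : 0 < (st n).2.
  by elim: n => [//|n IH] /=; have [] := hg (st n, n) IH.
have st_small n : (st n).2 <= 2^-1 ^+ n.
  elim: n => [|n IH]; first by rewrite expr0.
  have [_ + _ _] := hg (st n, n) (st0 n); move=> /le_trans; apply.
  by rewrite exprS mulrC ler_wpM2l // invr_ge0.
have st_nest n m y : nrm s (y - (st (n + m)%N).1) <= (st (n + m)%N).2 ->
    nrm s (y - (st n).1) <= (st n).2.
  elim: m => [|m IH]; first by rewrite addn0.
  rewrite addnS /= => h; apply: IH.
  by have [_ _ + _] := hg (st (n + m)%N, (n + m)%N) (st0 _); apply.
have st_dist n m : (n <= m)%N -> nrm s ((st m).1 - (st n).1) <= (st n).2.
  move=> nm; apply: (st_nest n (m - n)%N).
  by rewrite subnKC // subrr nrm0 ltW.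
have [||x hx] := cE (fun e x => exists2 n, (st n).2 <= e & x = (st n).1).
- move=> e e0; have := @near_infty_natSinv_expn_lt R (PosNum e0).
  move=> [n _ /(_ n (leqnn n)) /= hn].
  exists (st n).1, n => //; apply: le_trans (st_small n) _.
  by move: hn; rewrite div1r exprVn => /ltW.
- move=> e e' _ _ e0 e'0 [n ne ->] [m me ->].
  have [nm|/ltnW mn] := leqP n m.
    by rewrite nrmBC; apply: le_trans (st_dist _ _ nm) _; lra.
  by apply: le_trans (st_dist _ _ mn) _; lra.
have [M hM] := pb x.
pose n := (Num.truncn M).+1.
have [_ _ _ [i Di hi]] := hg (st n, n) (st0 n).
have /hi /= : nrm s (x - (st n.+1).1) <= (st n.+1).2.
  by rewrite nrmBC; apply: (hx _ _ (st0 n.+1)); exists n.+1.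
have := hM i Di; have : M < n%:R by apply: truncnS_gt.
lra.
Qed.

End BoundedOperators.

(** * Semigroups and integrals of their orbits *)

(** What strong continuity is used for: continuity at 0 and bounds on compact
    time intervals.  In this form it is inherited by exponential rescalings and
    by the diagonal entries of a triangular semigroup. *)
Record semigroup (R : realType) (K : numFieldType) (s : scalars R K)
    (E : normedModType K) (T : R -> E -> E) : Prop := Semigroup {
  sg_linear : forall t, 0 <= t -> linear (T t);
  sg_0 : forall x, T 0 x = x;
  sg_D : forall t r, 0 <= t -> 0 <= r -> forall x, T (t + r) x = T t (T r x);
  sg_cont0 : forall x (e : R), 0 < e ->
    exists2 d, 0 < d & forall t, 0 <= t <= d -> nrm s (T t x - x) <= e;
  sg_bound : forall L, exists2 M, 1 <= M &
    forall t x, 0 <= t <= L -> nrm s (T t x) <= M * nrm s x }.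

(** The graph of the generator: y = Ax means that T(t)x = x + ty + o(t).
    Difference quotients are avoided so that estimates add up without
    division. *)
Definition orbit_deriv (R : realType) (K : numFieldType) (s : scalars R K)
    (E : normedModType K) (T : R -> E -> E) (x y : E) : Prop :=
  forall e : R, 0 < e -> exists2 d, 0 < d & forall t, 0 < t <= d ->
    nrm s (T t x - x - of_real s t *: y) <= e * t.

Section Semigroups.
Context (R : realType) (K : numFieldType) (s : scalars R K).
Context (E : normedModType K) (T : R -> E -> E).
Hypothesis sgT : semigroup s T.

Local Notation "t %:K" := (of_real s t) (at level 2, format "t %:K").
Local Notation nm := (nrm s).

Lemma sg_comm t r x : 0 <= t -> 0 <= r -> T t (T r x) = T r (T t x).
Proof. by move=> t0 r0; rewrite -!(sg_D sgT) // addrC. Qed.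

Lemma orbit_deriv_unique x y y' :
  orbit_deriv s T x y -> orbit_deriv s T x y' -> y = y'.
Proof.
move=> hy hy'; apply/eqP; rewrite -subr_eq0; apply/eqP; apply: (nrm_le0 (s := s)).
move=> e e0; have e20 : 0 < e / 2 by lra.
have [d d0 hd] := hy _ e20; have [d' d'0 hd'] := hy' _ e20.
pose t := Num.min d d'; have t0 : 0 < t by rewrite lt_min d0.
have td : 0 < t <= d by rewrite t0 ge_min lexx.
have td' : 0 < t <= d' by rewrite t0 ge_min lexx orbT.
rewrite -(ler_pM2l t0) -nrmZr ?(ltW t0) //.
rewrite (_ : t * e = e / 2 * t + e / 2 * t); last by lra.
by apply: nrm_le2B (hd' t td') (hd t td) _; module_eq K.
Qed.

Lemma orbit_deriv_linear a x y x' y' :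
  orbit_deriv s T x y -> orbit_deriv s T x' y' ->
  orbit_deriv s T (a *: x + x') (a *: y + y').
Proof.
move=> hy hy' e e0.
have a0 := absK_ge0 s a.
have e10 : 0 < e / (2 * (absK s a + 1)) by apply: divr_gt0 => //; lra.
have e20 : 0 < e / 2 by lra.
have [d d0 hd] := hy _ e10; have [d' d'0 hd'] := hy' _ e20.
exists (Num.min d d'); first by rewrite lt_min d0.
move=> t; rewrite le_min => /and3P[t0 td td'].
rewrite (_ : e * t = e / 2 * t + e / 2 * t); last by lra.
apply: (@nrm_split _ _ _ _ _ _ (a *: (T t x - x - t%:K *: y))
                               (T t x' - x' - t%:K *: y')).
- by rewrite (sg_linear sgT (ltW t0)); module_eq K.
- rewrite nrmZ; have := hd t; rewrite t0 td => /(_ isT) h.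
  apply: le_trans (ler_wpM2l a0 h) _.
  rewrite (_ : absK s a * _ = (e / 2 * t) * (absK s a / (absK s a + 1))); last first.
    by field; rewrite gt_eqF //; lra.
  rewrite -[leRHS]mulr1 ler_wpM2l //; first by rewrite mulr_ge0 // ltW.
  by rewrite ler_pdivrMr; lra.
- by apply: hd'; rewrite t0.
Qed.

Lemma orbit_deriv0 : orbit_deriv s T 0 0.
Proof.
move=> e e0; exists 1 => // t /andP[t0 _].
by rewrite (lin0 (sg_linear sgT (ltW t0))) scaler0 !subr0 nrm0 mulr_ge0 // ltW.
Qed.

Lemma orbit_derivD x y x' y' : orbit_deriv s T x y -> orbit_deriv s T x' y' ->
  orbit_deriv s T (x + x') (y + y').
Proof. by move=> h h'; have := orbit_deriv_linear 1 h h'; rewrite !scale1r. Qed.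

Lemma orbit_derivB x y x' y' : orbit_deriv s T x y -> orbit_deriv s T x' y' ->
  orbit_deriv s T (x - x') (y - y').
Proof.
move=> h h'; have := orbit_deriv_linear (-1) h' h.
by rewrite !scaleN1r ![- _ + _]addrC.
Qed.

Lemma orbit_deriv_orbit t x y : 0 <= t ->
  orbit_deriv s T x y -> orbit_deriv s T (T t x) (T t y).
Proof.
move=> t0 hy e e0; have [M M1 hM] := sg_bound sgT t.
have [|d d0 hd] := hy (e / M); first by apply: divr_gt0 => //; lra.
exists d => // r rd; have r0 : 0 <= r by case/andP: rd => /ltW.
rewrite sg_comm // -(linZ (sg_linear sgT t0)) -!(linB (sg_linear sgT t0)).
apply: le_trans (hM _ _ _) _; first by rewrite t0 lexx.
rewrite -ler_pdivlMl; last lra.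
by rewrite mulrA [M^-1 * e]mulrC; apply: hd.
Qed.

Definition orbit_sum (h : R) (m : nat) (x : E) : E :=
  \sum_(0 <= k < m) T (k%:R * h) x.

Lemma nrm_sum_le (m : nat) (f : nat -> E) c :
  (forall k, (k < m)%N -> nm (f k) <= c) ->
  nm (\sum_(0 <= k < m) f k) <= m%:R * c.
Proof.
elim: m => [|m IH] hf; first by rewrite big_geq // nrm0 mul0r.
rewrite big_nat_recr //= -natr1 mulrDl mul1r.
apply: nrm_le2 (IH _) (hf m (leqnn _)) _ => // k km.
by apply: hf; apply: ltnW.
Qed.

Lemma orbit_sum_linear h m : 0 <= h -> linear (orbit_sum h m).
Proof.
move=> h0 a x y; rewrite /orbit_sum scaler_sumr -big_split /=.
by apply: eq_bigr => k _; rewrite (sg_linear sgT) // mulr_ge0.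
Qed.

Lemma orbit_sum_comm h m t x : 0 <= h -> 0 <= t ->
  orbit_sum h m (T t x) = T t (orbit_sum h m x).
Proof.
move=> h0 t0; rewrite /orbit_sum (lin_sum (sg_linear sgT t0)).
by apply: eq_bigr => k _; rewrite sg_comm // mulr_ge0.
Qed.

(** Removing the common part of the sums over [0, p[ and [m, m + p[ leaves the
    same terms as for [0, m[ and [p, m + p[. *)
Lemma orbit_sum_shift h m p x : 0 <= h ->
  T (m%:R * h) (orbit_sum h p x) - orbit_sum h p x =
  orbit_sum h m (T (p%:R * h) x - x).
Proof.
move=> h0; have nh0 n : 0 <= n%:R * h by rewrite mulr_ge0.
have shift n q : T (n%:R * h) (orbit_sum h q x) =
    \sum_(n <= k < n + q) T (k%:R * h) x.
  rewrite (lin_sum (sg_linear sgT (nh0 n))) -{2}[n]add0n big_addn addKn.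
  apply: eq_bigr => k _.
  by rewrite -(sg_D sgT) // -mulrDl -natrD addnC.
rewrite (linB (orbit_sum_linear m h0)) orbit_sum_comm // !shift.
apply/eqP; rewrite subr_eq addrAC eq_sym subr_eq; apply/eqP.
rewrite /orbit_sum [in LHS]addrC [in RHS]addrC addnC.
by rewrite -!big_cat_nat //= ?leq_addl // addnC leq_addl.
Qed.

Lemma orbit_sum_mul h a b x : 0 <= h ->
  orbit_sum h (a * b) x = orbit_sum (b%:R * h) a (orbit_sum h b x).
Proof.
move=> h0; elim: a => [|a IH]; first by rewrite mul0n /orbit_sum !big_geq.
transitivity (orbit_sum h (a * b) x + T (a%:R * (b%:R * h)) (orbit_sum h b x)).
  2: by rewrite IH /orbit_sum big_nat_recr.
rewrite mulSn addnC /orbit_sum.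
rewrite (@big_cat_nat _ _ _ (a * b)%N) ?leq_addr //=.
congr (_ + _); rewrite mulrA -natrM.
rewrite (lin_sum (sg_linear sgT _)) ?mulr_ge0 //.
rewrite -{1}[(a * b)%N]add0n big_addn addKn; apply: eq_bigr => k _.
by rewrite -(sg_D sgT) ?mulr_ge0 // -mulrDl -natrD addnC.
Qed.

Lemma orbit_sum_bound h m x M : 0 <= h ->
  (forall t x, 0 <= t <= m%:R * h -> nm (T t x) <= M * nm x) ->
  nm (orbit_sum h m x) <= m%:R * (M * nm x).
Proof.
move=> h0 hM; apply: nrm_sum_le => k km; apply: hM.
by rewrite mulr_ge0 //= ler_wpM2r // ler_nat ltnW.
Qed.

Lemma orbit_sum_close h m x e : 0 <= h ->
  (forall t, 0 <= t <= m%:R * h -> nm (T t x - x) <= e) ->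
  nm (orbit_sum h m x - m%:R *: x) <= m%:R * e.
Proof.
move=> h0 he.
have -> : m%:R *: x = \sum_(0 <= k < m) x.
  by rewrite sumr_const_nat subn0 scaler_nat.
rewrite -sumrB; apply: nrm_sum_le => k km; apply: he.
by rewrite mulr_ge0 //= ler_wpM2r // ler_nat ltnW.
Qed.

(** Left Riemann sums of the orbit over [0, r].  Each dyadic step is a multiple
    of the later ones, so that [orbit_sum_mul] compares the sums. *)
Definition dyadic_sum (r : R) (n : nat) (x : E) : E :=
  (r / 2 ^+ n)%:K *: orbit_sum (r / 2 ^+ n) (2 ^ n) x.

Definition orbit_integral (r : R) (x v : E) : Prop :=
  forall e : R, 0 < e -> exists N, forall n, (N <= n)%N ->
    nm (dyadic_sum r n x - v) <= e.

Lemma dyadic_small (r c : R) : 0 < r -> 0 < c ->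
  exists N, forall n, (N <= n)%N -> r / 2 ^+ n <= c.
Proof.
move=> r0 c0; have cr0 : 0 < c / r by rewrite divr_gt0.
have [N _ hN] := near_infty_natSinv_expn_lt (PosNum cr0).
exists N => n /hN /= h; rewrite -ler_pdivlMl // mulrC.
by move: h; rewrite div1r => /ltW.
Qed.

Lemma dyadicM (r : R) n : (2 ^ n)%:R * (r / 2 ^+ n) = r.
Proof. by rewrite natrX mulrC divfK // expf_neq0 // pnatr_eq0. Qed.

Lemma dyadicA (r c : R) n : r / 2 ^+ n * ((2 ^ n)%:R * c) = r * c.
Proof. by rewrite -[in RHS](dyadicM r n); ring. Qed.

Lemma dyadic_gt0 (r : R) n : 0 < r -> 0 < r / 2 ^+ n.
Proof. by move=> r0; rewrite divr_gt0 // exprn_gt0. Qed.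

(** By the semigroup law, refining a step of length h replaces x by an average
    of its orbit over [0, h] under each operator T(kh).  Continuity at 0 alone
    therefore controls the difference, uniformly along the orbit. *)
Lemma dyadic_sum_cauchy r x e M n N : 0 < r -> (n <= N)%N -> 0 <= M ->
  (forall t x, 0 <= t <= r -> nm (T t x) <= M * nm x) ->
  (forall t, 0 <= t <= r / 2 ^+ n -> nm (T t x - x) <= e) ->
  nm (dyadic_sum r N x - dyadic_sum r n x) <= r * (M * e).
Proof.
move=> r0 nN M0 hM he.
set h := r / 2 ^+ n; set h' := r / 2 ^+ N; pose b := (2 ^ (N - n))%N.
have h0 : 0 < h := dyadic_gt0 n r0; have h'0 : 0 < h' := dyadic_gt0 N r0.
have bh : b%:R * h' = h.
  have r2 m : (2 ^+ m : R) != 0 by rewrite expf_neq0 // pnatr_eq0.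
  rewrite /b natrX /h /h' -{2}(subnK nN) exprD.
  by field; rewrite !r2.
have -> : dyadic_sum r N x =
    orbit_sum h (2 ^ n) (h'%:K *: orbit_sum h' b x).
  rewrite /dyadic_sum -/h' -{1}(subnKC nN) expnD orbit_sum_mul ?(ltW h'0) //.
  by rewrite -/b bh (linZ (orbit_sum_linear _ (ltW h0))).
rewrite /dyadic_sum -/h -(linZ (orbit_sum_linear _ (ltW h0))).
rewrite -(linB (orbit_sum_linear _ (ltW h0))).
apply: le_trans (orbit_sum_bound (M := M) _ (ltW h0) _) _.
  by move=> t y; rewrite dyadicM; apply: hM.
have -> : r * (M * e) = (2 ^ n)%:R * (M * (h * e)).
  by rewrite -{1}(dyadicM r n) -/h; ring.
rewrite ler_wpM2l // ler_wpM2l //.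
have -> : h'%:K *: orbit_sum h' b x - h%:K *: x =
    h'%:K *: (orbit_sum h' b x - b%:R *: x).
  by rewrite -bh (rmorphM _ b%:R) rmorph_nat; module_eq K.
rewrite nrmZr ?(ltW h'0) // (_ : h * e = h' * (b%:R * e)); last first.
  by rewrite -bh; ring.
apply: ler_wpM2l (ltW h'0) _ _ _; apply: orbit_sum_close (ltW h'0) _.
by rewrite bh.
Qed.

Lemma orbit_integral_exists r x : approx_complete s E -> 0 < r ->
  exists v, orbit_integral r x v.
Proof.
move=> cE r0; have [M M1 hM] := sg_bound sgT r.
have M0 : 0 < M by lra.
have cauchy e : 0 < e -> exists n, forall m, (n <= m)%N ->
    nm (dyadic_sum r m x - dyadic_sum r n x) <= e.
  move=> e0; have [|d d0 hd] := sg_cont0 sgT x (e := e / (r * M)).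
    by rewrite divr_gt0 ?mulr_gt0.
  have [n hn] := dyadic_small r0 d0.
  exists n => m nm'.
  apply: le_trans (dyadic_sum_cauchy (e := e / (r * M)) r0 nm' (ltW M0) hM _) _.
    move=> t /andP[t0 tn]; apply: hd; rewrite t0 (le_trans tn) //.
    exact: hn.
  by rewrite (_ : r * _ = e) //; field; rewrite !gt_eqF.
have [||v hv] := cE (fun e v => exists2 n, v = dyadic_sum r n x &
    forall m, (n <= m)%N -> nm (dyadic_sum r m x - dyadic_sum r n x) <= e).
- by move=> e /cauchy[n hn]; exists (dyadic_sum r n x), n.
- move=> e e' _ _ e0 e'0 [n -> hn] [n' -> hn'].
  apply: (@nrm_split _ _ _ _ _ _ (dyadic_sum r n x - dyadic_sum r (maxn n n') x)
    (dyadic_sum r (maxn n n') x - dyadic_sum r n' x)).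
  + by module_eq K.
  + by rewrite nrmBC hn // leq_maxl.
  + by rewrite hn' // leq_maxr.
exists v => e e0; have [|n hn] := cauchy (e / 2); first by lra.
exists n => m nm'; have -> : e = e / 2 + e / 2 by lra.
have {}hv : nm (dyadic_sum r n x - v) <= e / 2 by apply: hv; [lra | exists n].
by apply: nrm_le2 (hn m nm') hv _; module_eq K.
Qed.

Lemma orbit_integral_lim_le r x v (f : E -> E) b :
  orbit_integral r x v -> (forall x y, f x - f y = x - y) ->
  (forall n, nm (f (dyadic_sum r n x)) <= b) -> nm (f v) <= b.
Proof.
move=> hv hf hb; apply: le_eps => e e0; have [N hN] := hv e e0.
apply: nrm_le2B (hb N) (hN N (leqnn N)) _.
by rewrite -(hf _ v); module_eq K.
Qed.

Lemma orbit_integral_linear r a x v x' v' : 0 < r ->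
  orbit_integral r x v -> orbit_integral r x' v' ->
  orbit_integral r (a *: x + x') (a *: v + v').
Proof.
move=> r0 hv hv' e e0; have a0 := absK_ge0 s a.
have [|N hN] := hv (e / (2 * (absK s a + 1))); first by apply: divr_gt0 => //; lra.
have [|N' hN'] := hv' (e / 2); first by lra.
exists (maxn N N') => n; rewrite geq_max => /andP[nN nN'].
rewrite (_ : e = e / 2 + e / 2); last by lra.
apply: (@nrm_split _ _ _ _ _ _ (a *: (dyadic_sum r n x - v))
                               (dyadic_sum r n x' - v')); last exact: hN'.
  rewrite /dyadic_sum (orbit_sum_linear _ (ltW (dyadic_gt0 n r0))).
  by module_eq K.
rewrite nrmZ; apply: le_trans (ler_wpM2l a0 (hN n nN)) _.
rewrite (_ : absK s a * _ = (e / 2) * (absK s a / (absK s a + 1))); last first.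
  by field; rewrite gt_eqF //; lra.
rewrite -[leRHS]mulr1 ler_wpM2l //; first by lra.
by rewrite ler_pdivrMr; lra.
Qed.

Lemma orbit_integral_comm r x v t : 0 < r -> 0 <= t ->
  orbit_integral r x v -> orbit_integral r (T t x) (T t v).
Proof.
move=> r0 t0 hv e e0; have [M M1 hM] := sg_bound sgT t.
have [|N hN] := hv (e / M); first by rewrite divr_gt0 //; lra.
exists N => n /hN h; have hn := dyadic_gt0 n r0.
rewrite /dyadic_sum orbit_sum_comm ?(ltW hn) //.
rewrite -(linZ (sg_linear sgT t0)) -(linB (sg_linear sgT t0)).
apply: le_trans (hM _ _ _) _; first by rewrite t0 lexx.
rewrite -ler_pdivlMl; last by lra.
by rewrite [M^-1 * e]mulrC.
Qed.

(** For a time mq commensurable with the step q of the Riemann sum w,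
    [orbit_sum_shift] gives T(mq)w - w exactly, as a Riemann sum of the orbit of
    T(r)x - x over [0, mq].  An arbitrary time h is less than one step away from
    such a time. *)
Lemma orbit_integral_deriv r x v : 0 < r ->
  orbit_integral r x v -> orbit_deriv s T v (T r x - x).
Proof.
move=> r0 hv e e0; have [M M1 hM] := sg_bound sgT r.
set u := T r x - x.
have [d d0 hd] := sg_cont0 sgT u e0.
exists (Num.min d r); first by rewrite lt_min d0.
move=> h; rewrite le_min => /and3P[h0 hd' hr].
apply: le_eps => z z0.
pose z' := z / (2 * M + 2); have z'0 : 0 < z' by rewrite divr_gt0 //; lra.
have [c c0 hc] := sg_cont0 sgT v z'0.
have [N1 hN1] := hv z' z'0.
have [N2 hN2] := dyadic_small r0 c0.
have [|N3 hN3] := dyadic_small r0 (c := z' / (nm u + 1)).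
  by rewrite divr_gt0 //; have := nrm_ge0 s u; lra.
pose n := maxn N1 (maxn N2 N3).
have {}hN1 := hN1 n (leq_maxl _ _).
have {}hN2 : r / 2 ^+ n <= c by apply: hN2; rewrite !leq_max leqnn orbT.
have {}hN3 : r / 2 ^+ n <= z' / (nm u + 1).
  by apply: hN3; rewrite !leq_max leqnn !orbT.
set q := r / 2 ^+ n in hN2 hN3; have q0 : 0 < q := dyadic_gt0 n r0.
(* mq is the last multiple of the step before h. *)
pose m := Num.truncn (h / q).
have hq0 : 0 <= h / q by rewrite divr_ge0 // ltW.
have /andP[] := truncn_itv hq0; rewrite -/m ler_pdivlMr // ltr_pdivrMr // => mh hm.
have mq0 : 0 <= m%:R * q by rewrite mulr_ge0 // ltW.
have hmq : h - m%:R * q <= q by move: hm; rewrite -natr1 mulrDl mul1r; lra.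
set w := dyadic_sum r n x in hN1.
have mr : 0 <= m%:R * q <= r by rewrite mq0 (le_trans mh).
have part1 : nm (T h v - T (m%:R * q) v) <= M * z'.
  have -> : T h v = T (m%:R * q) (T (h - m%:R * q) v).
    by rewrite -(sg_D sgT) ?subr_ge0 // addrC subrK.
  rewrite -(linB (sg_linear sgT mq0)); apply: le_trans (hM _ _ mr) _.
  by rewrite ler_wpM2l //; [lra | apply: hc; lra].
have part2 : nm (T (m%:R * q) v - T (m%:R * q) w) <= M * z'.
  rewrite -(linB (sg_linear sgT mq0)); apply: le_trans (hM _ _ mr) _.
  by rewrite ler_wpM2l ?(nrmBC _ v) //; lra.
have part3 : nm (T (m%:R * q) w - w - (m%:R * q)%:K *: u) <= e * h.
  rewrite /w /dyadic_sum -/q (linZ (sg_linear sgT mq0)) -scalerBr.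
  rewrite orbit_sum_shift ?(ltW q0) // dyadicM -/u (rmorphM _ m%:R) mulrC -scalerA.
  rewrite -scalerBr nrmZr ?(ltW q0) //.
  have : nm (orbit_sum q m u - m%:R *: u) <= m%:R * e.
    by apply: orbit_sum_close; [exact: ltW | move=> t ht; apply: hd; lra].
  rewrite rmorph_nat => /(ler_wpM2l (ltW q0)) /le_trans; apply.
  by rewrite mulrA [q * _]mulrC [e * h]mulrC ler_wpM2r // ltW.
have part4 : nm ((m%:R * q - h)%:K *: u) <= z'.
  rewrite nrmZ absK_of_real distrC ger0_norm; last by lra.
  have u0 := nrm_ge0 s u.
  apply: (@le_trans _ _ (z' / (nm u + 1) * nm u)).
    by rewrite ler_wpM2r //; lra.
  by rewrite mulrAC ler_pdivrMr ?ler_wpM2l; lra.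
have -> : e * h + z = (M * z' + M * z') + (e * h + (z' + z')).
  by rewrite /z'; field; rewrite gt_eqF //; lra.
apply: nrm_le2 (nrm_le2 part1 part2 erefl)
  (nrm_le2 part3 (nrm_le2 hN1 part4 erefl) erefl) _.
by rewrite rmorphB; module_eq K.
Qed.

Lemma orbit_integral_bound r x v M : 0 < r -> 0 <= M ->
  (forall t x, 0 <= t <= r -> nm (T t x) <= M * nm x) ->
  orbit_integral r x v -> nm v <= r * (M * nm x).
Proof.
move=> r0 M0 hM hv; apply: (orbit_integral_lim_le (f := id) hv) => // n.
have q0 := dyadic_gt0 n r0; rewrite nrmZr ?(ltW q0) //.
apply: le_trans (ler_wpM2l (ltW q0) (orbit_sum_bound (M := M) _ (ltW q0) _)) _.
  by move=> t y; rewrite dyadicM; apply: hM.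
by rewrite dyadicA.
Qed.

Lemma orbit_integral_close r x v e : 0 < r ->
  (forall t, 0 <= t <= r -> nm (T t x - x) <= e) ->
  orbit_integral r x v -> nm (v - r%:K *: x) <= r * e.
Proof.
move=> r0 he hv; apply: (orbit_integral_lim_le (f := fun w => w - r%:K *: x) hv).
  by move=> y z; module_eq K.
move=> n; have q0 := dyadic_gt0 n r0; rewrite /dyadic_sum.
set q := r / 2 ^+ n in q0 *.
have -> : r%:K = q%:K * (2 ^ n)%:R.
  by rewrite -(rmorph_nat (of_real s)) -rmorphM mulrC dyadicM.
rewrite -scalerA -scalerBr nrmZr ?(ltW q0) //.
apply: le_trans (ler_wpM2l (ltW q0) (orbit_sum_close (e := e) (ltW q0) _)) _.
  by move=> t; rewrite dyadicM; apply: he.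
by rewrite dyadicA.
Qed.

(** Integration over [0, r] is bounded and commutes with the semigroup, so it
    may be applied to T(t)x - x - ty.  It turns this into
    T(t)w - w - tv, where w is the integral of the orbit of x; hence v is the
    derivative of the orbit of w, which [orbit_integral_deriv] computes. *)
Lemma orbit_integral_of_deriv r x y v : approx_complete s E -> 0 < r ->
  orbit_deriv s T x y -> orbit_integral r y v -> v = T r x - x.
Proof.
move=> cE r0 hy hv; have [w hw] := orbit_integral_exists x cE r0.
have [M M1 hM] := sg_bound sgT r.
apply: (orbit_deriv_unique (x := w)); last exact: orbit_integral_deriv hw.
move=> e e0; have [|d d0 hd] := hy (e / (r * M)).
  by rewrite divr_gt0 // mulr_gt0 //; lra.
exists d => // t td; have t0 : 0 <= t by case/andP: td => /ltW.
have hint : orbit_integral r (T t x - x - t%:K *: y) (T t w - w - t%:K *: v).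
  have -> : T t x - x - t%:K *: y = (- t%:K) *: y + ((-1) *: x + T t x).
    by module_eq K.
  have -> : T t w - w - t%:K *: v = (- t%:K) *: v + ((-1) *: w + T t w).
    by module_eq K.
  apply: orbit_integral_linear => //; apply: orbit_integral_linear => //.
  exact: orbit_integral_comm.
have M0 : 0 <= M by lra.
apply: le_trans (orbit_integral_bound r0 M0 hM hint) _.
rewrite mulrA -ler_pdivlMl ?mulr_gt0 //; last by lra.
by rewrite mulrA [_^-1 * e]mulrC; apply: hd.
Qed.

(** The increment T(r)x - x is the integral over [0, r] of the orbit of Ax. *)
Lemma orbit_lipschitz r x y M : approx_complete s E -> 0 < r -> 0 <= M ->
  (forall t x, 0 <= t <= r -> nm (T t x) <= M * nm x) ->
  orbit_deriv s T x y -> nm (T r x - x) <= r * (M * nm y).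
Proof.
move=> cE r0 M0 hM hy; have [v hv] := orbit_integral_exists y cE r0.
by rewrite -(orbit_integral_of_deriv cE r0 hy hv); apply: orbit_integral_bound hv.
Qed.

(** Averages of an orbit over short intervals belong to the domain and are
    close to the starting point. *)
Lemma orbit_deriv_dense x e : approx_complete s E -> 0 < e ->
  exists x' y', orbit_deriv s T x' y' /\ nm (x' - x) <= e.
Proof.
move=> cE e0; have [d d0 hd] := sg_cont0 sgT x e0.
have [v hv] := orbit_integral_exists x cE d0.
exists (d^-1%:K *: v), (d^-1%:K *: (T d x - x)); split.
  have := orbit_deriv_linear d^-1%:K (orbit_integral_deriv d0 hv) orbit_deriv0.
  by rewrite !addr0.
have -> : d^-1%:K *: v - x = d^-1%:K *: (v - d%:K *: x).
  by rewrite scalerBr scalerA -rmorphM mulVf ?gt_eqF // rmorph1 scale1r.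
rewrite nrmZr ?invr_ge0 ?(ltW d0) // ler_pdivrMl //.
exact: orbit_integral_close.
Qed.

End Semigroups.

(** * Strong continuity and resolvent points *)

Section C0Semigroups.
Context (R : realType) (K : numFieldType) (s : scalars R K).
Local Notation "t %:K" := (of_real s t) (at level 2, format "t %:K").
Local Notation nm := (nrm s).

Lemma near_rightP (P : R -> Prop) :
  (\forall t \near 0^'+, P t) <->
  exists2 d : R, 0 < d & forall t, 0 < t <= d -> P t.
Proof.
rewrite /at_right near_withinE; split.
  move=> /nbhs_ballP[d /= d0 hd]; exists (d / 2); first by rewrite divr_gt0.
  move=> t /andP[t0 td]; apply: hd => //; rewrite -ball_normE /= sub0r normrN.
  by rewrite gtr0_norm //; lra.
move=> [d d0 hd]; apply/nbhs_ballP; exists d => // t /=.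
rewrite -ball_normE /= sub0r normrN => td t0.
by apply: hd; rewrite t0 /=; move: td; rewrite gtr0_norm // => /ltW.
Qed.

Lemma generatorP (E : normedModType K) (T : R -> E -> E) x y :
  dom (generator s T) x /\ generator s T x = y <-> orbit_deriv s T x y.
Proof.
pose q t := t%:K^-1 *: (T t x - x).
have qE t : 0 < t -> nm (T t x - x - t%:K *: y) = t * nm (q t - y).
  move=> t0; rewrite -nrmZr ?(ltW t0) // /q scalerBr scalerA mulfV ?scale1r //.
  by rewrite fmorph_eq0 gt_eqF.
have qP : orbit_deriv s T x y <-> q t @[t --> 0^'+] --> y.
  split.
    move=> hy; apply/(cvg_nrmP s) => e e0; apply/near_rightP.
    have [|d d0 hd] := hy (e / 2); first by lra.
    exists d => // t td; have /andP[t0 _] := td.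
    have := hd t td; rewrite qE // mulrC ler_pM2r // => h.
    by apply: le_lt_trans h _; lra.
  move=> /(cvg_nrmP s) hy e e0; have /near_rightP[d d0 hd] := hy e e0.
  exists d => // t td; have /andP[t0 _] := td.
  by rewrite qE // mulrC ler_pM2r // ltW // hd.
rewrite qP; split=> [[/= cq <-]|/[dup] /cvgP cq /cvg_lim lq] //.
by split=> //=; apply: lq.
Qed.

Lemma right_contP (E : normedModType K) (T : R -> E -> E) x :
  {within `[0, +oo[, continuous (fun t => T t x)} ->
  forall t (e : R), 0 <= t -> 0 < e -> exists2 d : R, 0 < d &
    forall r, 0 <= r -> `|r - t| <= d -> nm (T r x - T t x) <= e.
Proof.
move=> /subspace_continuousP cT t e t0 e0.
have := cT t; rewrite /= in_itv /= t0 => /(_ isT) /(cvg_nrmP s) /(_ e e0).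
rewrite near_withinE => /nbhs_ballP[d /= d0 hd].
exists (d / 2); first by rewrite divr_gt0.
move=> r r0 rd; apply/ltW/hd; last by rewrite in_itv /= r0.
by rewrite -ball_normE /= distrC; apply: le_lt_trans rd _; lra.
Qed.

(** Orbits are bounded on compact intervals by continuity; the uniform
    boundedness principle makes these bounds uniform in the starting point. *)
Lemma C0_semigroupP (E : normedModType K) (T : R -> E -> E) :
  approx_complete s E -> C0_semigroup T -> semigroup s T.
Proof.
move=> cE [opT T0 TD cT]; split=> //.
- by move=> t /opT[].
- move=> x e e0; have [d d0 hd] := right_contP (cT x) (lexx 0) e0.
  exists d => // t /andP[t0 td]; have := hd t t0.
  by rewrite T0 subr0 ger0_norm //; apply.
move=> L; have [L0|L0] := ltP L 0.
  by exists 1 => // t x /andP[t0 tL]; lra.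
pose D := [set t : R | 0 <= t <= L].
have [||M M1 hM] := uniform_boundedness (s := s) (D := D) (f := T) cE.
- by move=> t /andP[t0 _]; apply: opT.
- move=> x; have : {within `[0, L], continuous (fun t => nm (T t x))}.
    apply/subspace_continuousP => t; rewrite /= in_itv /= => /andP[t0 tL].
    apply/cvgrPdist_lt => e e0; rewrite near_withinE.
    have e20 : 0 < e / 2 by lra.
    have [d d0 hd] := right_contP (cT x) t0 e20.
    apply/nbhs_ballP; exists d => // r /=; rewrite -ball_normE /= => rd.
    rewrite in_itv /= => /andP[r0 _].
    have := hd r r0; rewrite distrC (ltW rd) => /(_ isT) h.
    apply: (@le_lt_trans _ _ (e / 2)); last lra.
    by rewrite /from_subspace distrC; apply: le_trans (nrm_dist _ _ _) h.
  move=> /(EVT_max L0)[c _ hc]; exists (nm (T c x)) => t tD.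
  by apply: hc; rewrite in_itv.
by exists M => // t x tD; apply: hM.
Qed.

End C0Semigroups.

Section Resolvents.
Context (R : realType) (K : numFieldType) (s : scalars R K).
Local Notation "t %:K" := (of_real s t) (at level 2, format "t %:K").
Local Notation nm := (nrm s).

(** The graph form of membership in the resolvent set: l - A is onto, and an
    estimate gives both its injectivity and the continuity of the inverse. *)
Definition resolvent_point (E : normedModType K) (T : R -> E -> E) (l : K) :=
  (forall x, exists y, orbit_deriv s T y (l *: y - x)) /\
  exists2 C : R, 0 <= C &
    forall y w, orbit_deriv s T y w -> nm y <= C * nm (l *: y - w).

(** Let V be the integration of orbits over [0, 1], so that AVz = T(1)z - z, and
    VAy = T(1)y - y for y in the domain.  Since T(1) is a strict contraction,
    T(1) - 1 is invertible by the Neumann series, whose partial sums are orbit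
    sums of step 1; hence A is invertible as well. *)
Lemma contractive_resolvent_point (E : normedModType K) (T : R -> E -> E) :
  approx_complete s E -> semigroup s T ->
  (forall x, nm (T 1 x) <= nm x / 2) -> resolvent_point T 0.
Proof.
move=> cE sgT half; have [M M1 hM] := sg_bound sgT 1.
have M0 : 0 <= M by lra.
split; last first.
  exists (2 * M); first by rewrite mulr_ge0.
  move=> y w hy; have := orbit_lipschitz sgT cE ltr01 M0 hM hy.
  have := nrmD s (T 1 y) (y - T 1 y); rewrite nrmBC.
  rewrite (_ : T 1 y + (y - T 1 y) = y); last by module_eq K.
  rewrite scale0r sub0r nrmN mul1r; have := half y; lra.
move=> x; pose u n := orbit_sum T 1 n x.
have uT n : T 1 (u n) - u n = T n%:R x - x.
  have := orbit_sum_shift sgT 1 n x ler01.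
  by rewrite !mulr1 /u {3}/orbit_sum big_nat1 mul0r (sg_0 sgT).
have Tn n y : nm (T n%:R y) <= 2^-1 ^+ n * nm y.
  elim: n y => [|n IH] y; first by rewrite (sg_0 sgT) mul1r.
  rewrite -natr1 (sg_D sgT) //; apply: le_trans (IH _) _.
  by rewrite exprSr -mulrA ler_wpM2l ?exprn_ge0 ?invr_ge0 // mulrC.
have ub n : nm (u n) <= 4 * nm x.
  have := nrmD s (T 1 (u n)) (u n - T 1 (u n)); rewrite nrmBC uT.
  rewrite (_ : T 1 (u n) + _ = u n); last by module_eq K.
  have := nrmD s (T n%:R x) (- x); rewrite nrmN.
  have : 2^-1 ^+ n * nm x <= nm x.
    by rewrite ler_piMl ?nrm_ge0 // exprn_ile1 // invr_le1 // ?unitf_gt0 // ler1n.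
  have := half (u n); have := Tn n x; lra.
have ud n m : (n <= m)%N -> nm (u m - u n) <= 2^-1 ^+ n * (4 * nm x).
  move=> nm'; have -> : u m - u n = T n%:R (u (m - n)%N).
    rewrite -{1}(subnKC nm') /u /orbit_sum.
    rewrite (@big_cat_nat _ _ _ n) ?leq_addr //= [LHS]addrC addKr.
    rewrite (lin_sum (sg_linear sgT _)) // -{1}[n]add0n big_addn addKn.
    apply: eq_bigr => k _; rewrite -(sg_D sgT) ?mulr_ge0 //.
    by rewrite !mulr1 -natrD addnC.
  by apply: le_trans (Tn _ _) _; rewrite ler_wpM2l ?exprn_ge0 ?invr_ge0.
have small (e : R) : 0 < e -> exists n, 2^-1 ^+ n * (4 * nm x) <= e.
  move=> e0; have x0 := nrm_ge0 s x.
  have c0 : 0 < 4 * nm x + 1 by lra.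
  have [n hn] := dyadic_small c0 e0.
  exists n; apply: le_trans (hn n (leqnn n)).
  by rewrite mulrC exprVn ler_wpM2r ?invr_ge0 ?exprn_ge0 //; lra.
have [||z hz] := cE (fun e z => exists2 n, z = u n & 2^-1 ^+ n * (4 * nm x) <= e).
- by move=> e /small[n hn]; exists (u n), n.
- move=> e e' _ _ e0 e'0 [n -> hn] [m -> hm].
  have [nm'|/ltnW mn] := leqP n m.
    by rewrite nrmBC; apply: le_trans (ud _ _ nm') _; lra.
  by apply: le_trans (ud _ _ mn) _; lra.
have zE : T 1 z - z = - x.
  apply/eqP; rewrite -subr_eq0; apply/eqP; apply: (nrm_le0 (s := s)) => e e0.
  have e40 : 0 < e / 4 by lra.
  have [n hn] := small _ e40.
  have unz : nm (u n - z) <= e / 4 by apply: hz => //; exists n.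
  have Tnx : nm (T n%:R x) <= e / 4.
    apply: le_trans (Tn _ _) _; apply: le_trans hn.
    by rewrite ler_wpM2l ?exprn_ge0 ?invr_ge0 //; have := nrm_ge0 s x; lra.
  have Tunz : nm (T 1 (u n - z)) <= e / 4.
    by apply: le_trans (half _) _; have := nrm_ge0 s (u n - z); lra.
  have : nm (T 1 z - z - - x) <= e / 4 + (e / 4 + e / 4).
    apply: nrm_le2 unz (nrm_le2B Tnx Tunz erefl) _.
    have lin1 : linear (T 1) by apply: (sg_linear sgT).
    rewrite (linB lin1) (_ : T 1 (u n) = u n + (T n%:R x - x)).
      by module_eq K.
    by rewrite -uT; module_eq K.
  by move=> /le_trans; apply; lra.
have [v hv] := orbit_integral_exists sgT z cE ltr01.
exists v; rewrite scale0r sub0r -zE.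
exact: orbit_integral_deriv hv.
Qed.

Definition rescaled (E : normedModType K) (a : R) (T : R -> E -> E) t x :=
  (expR (a * t))%:K *: T t x.

Lemma expR_cont0 (a e : R) : 0 < e ->
  exists2 d : R, 0 < d & forall t, 0 <= t <= d -> `|expR (a * t) - 1| <= e.
Proof.
move=> e0; have : (fun t => expR (a * t)) t @[t --> 0] --> expR (a * 0).
  apply: continuous_comp; first exact: mulrl_continuous.
  exact: continuous_expR.
move=> /cvgrPdist_le /(_ e e0) /nbhs_ballP[d /= d0 hd].
exists (d / 2); first by rewrite divr_gt0.
move=> t /andP[t0 td]; have := hd t; rewrite mulr0 expR0 distrC; apply.
by rewrite -ball_normE /= sub0r normrN ger0_norm //; lra.
Qed.

Lemma rescaled_semigroup (E : normedModType K) a (T : R -> E -> E) :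
  semigroup s T -> semigroup s (rescaled a T).
Proof.
move=> sgT; split.
- move=> t t0 c x y; rewrite /rescaled (sg_linear sgT t0).
  by module_eq K.
- by move=> x; rewrite /rescaled mulr0 expR0 rmorph1 scale1r (sg_0 sgT).
- move=> t r t0 r0 x; rewrite /rescaled (sg_D sgT) // (linZ (sg_linear sgT t0)).
  by rewrite scalerA -rmorphM -expRD mulrDr.
- move=> x e e0; have [M M1 hM] := sg_bound sgT 1.
  have x0 := nrm_ge0 s x.
  have [|d d0 hd] := expR_cont0 a (e := e / (2 * (M * nm x + 1))).
    by rewrite divr_gt0 // mulr_gt0 //; have := mulr_ge0 (le_trans ler01 M1) x0; lra.
  have [|d' d'0 hd'] := sg_cont0 sgT x (e := e / 2); first lra.
  exists (Num.min 1 (Num.min d d')); first by rewrite !lt_min d0 d'0 ltr01.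
  move=> t; rewrite !le_min => /and4P[t0 t1 td td'].
  rewrite (_ : e = e / 2 + e / 2); last lra.
  apply: (@nrm_split _ _ _ _ _ _ ((expR (a * t) - 1)%:K *: T t x) (T t x - x)).
  + by rewrite /rescaled rmorphB rmorph1; module_eq K.
  + rewrite nrmZ absK_of_real.
    have h1 : `|expR (a * t) - 1| <= e / (2 * (M * nm x + 1)) by rewrite hd ?t0.
    have h2 : nm (T t x) <= M * nm x by rewrite hM ?t0.
    apply: le_trans (ler_pM _ _ h1 h2) _; rewrite ?nrm_ge0 //.
    have Mx := mulr_ge0 (le_trans ler01 M1) x0.
    rewrite (_ : e / _ * _ = e / 2 * (M * nm x / (M * nm x + 1))); last first.
      by field; rewrite gt_eqF //; lra.
    by rewrite ler_piMr ?ler_pdivrMr //; lra.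
  + by apply: hd'; rewrite t0.
- move=> L; have [M M1 hM] := sg_bound sgT L.
  have a0 : 0 <= `|a| * `|L| by rewrite mulr_ge0.
  exists (expR (`|a| * `|L|) * M).
    by rewrite mulr_ege1 // -expR0 ler_expR.
  move=> t x /andP[t0 tL]; rewrite /rescaled nrmZr ?expR_ge0 // -mulrA.
  rewrite ler_pM ?expR_ge0 ?nrm_ge0 //; last by rewrite hM ?t0.
  rewrite ler_expR; apply: le_trans (ler_norm _) _; rewrite normrM.
  by rewrite ler_wpM2l // (ger0_norm t0) (le_trans tL) // ler_norm.
Qed.

(** Both bounds come from 1 + y <= exp y, applied to y = x and to y = - x. *)
Lemma expR_taylor1 (x : R) : `|x| <= 1 / 2 -> `|expR x - 1 - x| <= 2 * x ^+ 2.
Proof.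
rewrite ler_norml => /andP[x1 x2]; have h1 := expR_ge1Dx x.
have h2 := expR_ge1Dx (- x); have e0 := expR_gt0 x.
have h3 : expR x * (1 - x) <= 1.
  by rewrite -[leRHS](mulfV (lt0r_neq0 e0)) ler_pM2l // -expRN.
rewrite ger0_norm; last lra.
have : expR x <= (1 - x)^-1 by rewrite -[leRHS]mul1r ler_pdivlMr //; lra.
have : (1 - x)^-1 <= 1 + x + 2 * x ^+ 2.
  rewrite -[leLHS]mul1r ler_pdivrMr; last lra.
  have -> : (1 + x + 2 * x ^+ 2) * (1 - x) = 1 + x ^+ 2 * (1 - 2 * x) by ring.
  by rewrite lerDl mulr_ge0 ?sqr_ge0 //; lra.
lra.
Qed.

Lemma expR_deriv0 (a e : R) : 0 < e -> exists2 d : R, 0 < d &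
  forall t, 0 < t <= d -> `|expR (a * t) - 1 - a * t| <= e * t.
Proof.
move=> e0; have a0 := normr_ge0 a; have aa := sqr_ge0 a.
pose d1 := (2 * `|a| + 1)^-1; pose d2 := e / (2 * a ^+ 2 + 1).
exists (Num.min d1 d2).
  by rewrite lt_min invr_gt0 divr_gt0 //; lra.
move=> t; rewrite le_min => /and3P[t0 td1 td2].
have h1 : t * (2 * `|a| + 1) <= 1 by rewrite -ler_pdivlMr ?mul1r //; lra.
have h2 : t * (2 * a ^+ 2 + 1) <= e by rewrite -ler_pdivlMr //; lra.
apply: le_trans (expR_taylor1 _) _.
  by rewrite normrM (gtr0_norm t0); lra.
rewrite exprMn [t ^+ 2]expr2 !mulrA ler_wpM2r ?(ltW t0) //; lra.
Qed.

(** Product rule at time 0 for exp(at)T(t)x. *)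
Lemma rescaled_orbit_deriv (E : normedModType K) a (T : R -> E -> E) x y :
  semigroup s T -> orbit_deriv s T x y ->
  orbit_deriv s (rescaled a T) x (y + a%:K *: x).
Proof.
move=> sgT hy e e0; have x0 := nrm_ge0 s x; have y0 := nrm_ge0 s y.
have [|d1 d10 hd1] := hy (e / 8); first lra.
have [|d2 d20 hd2] := expR_deriv0 a (e := e / (4 * (nm x + 1))).
  by rewrite divr_gt0 //; lra.
have [|d3 d30 hd3] := expR_cont0 a (e := Num.min 1 (e / (4 * (nm y + 1)))).
  by rewrite lt_min ltr01 divr_gt0 //; lra.
exists (Num.min d1 (Num.min d2 d3)); first by rewrite !lt_min d10 d20.
move=> t; rewrite !le_min => /and4P[t0 t1 t2 t3].
have {}hd1 : nm (T t x - x - t%:K *: y) <= e / 8 * t by rewrite hd1 ?t0.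
have {}hd2 : `|expR (a * t) - 1 - a * t| <= e / (4 * (nm x + 1)) * t.
  by rewrite hd2 ?t0.
have : `|expR (a * t) - 1| <= Num.min 1 (e / (4 * (nm y + 1))).
  by rewrite hd3 ?(ltW t0).
rewrite le_min => /andP[hd4 hd5].
have p1 : nm ((expR (a * t))%:K *: (T t x - x - t%:K *: y)) <= 2 * (e / 8 * t).
  rewrite nrmZr ?expR_ge0 // ler_pM ?expR_ge0 ?nrm_ge0 //.
  by move: hd4; rewrite ler_norml; lra.
have p2 : nm ((expR (a * t) - 1 - a * t)%:K *: x) <= e / 4 * t.
  rewrite nrmZ absK_of_real; apply: le_trans (ler_wpM2r x0 hd2) _.
  rewrite (_ : e / _ * t * _ = e / 4 * t * (nm x / (nm x + 1))); last first.
    by field; rewrite gt_eqF //; lra.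
  by rewrite ler_piMr ?mulr_ge0 ?(ltW t0) ?ler_pdivrMr //; lra.
have p3 : nm ((t * (expR (a * t) - 1))%:K *: y) <= e / 4 * t.
  rewrite nrmZ absK_of_real normrM (gtr0_norm t0).
  rewrite mulrAC -mulrA mulrC; apply: ler_wpM2r (ltW t0) _ _ _.
  apply: le_trans (ler_wpM2l y0 hd5) _.
  rewrite (_ : _ * (e / _) = e / 4 * (nm y / (nm y + 1))); last first.
    by field; rewrite gt_eqF //; lra.
  by rewrite ler_piMr ?ler_pdivrMr //; lra.
have -> : e * t = 2 * (e / 8 * t) + (e / 4 * t + e / 4 * t) + e / 4 * t by lra.
have te : 0 <= e / 4 * t by rewrite mulr_ge0 //; lra.
apply: (@le_trans _ _ (2 * (e / 8 * t) + (e / 4 * t + e / 4 * t))); last lra.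
apply: nrm_le2 p1 (nrm_le2 p2 p3 erefl) _.
by rewrite /rescaled !(rmorphB, rmorphM, rmorph1); module_eq K.
Qed.

Lemma rescaledK (E : normedModType K) a (T : R -> E -> E) t x :
  rescaled (- a) (rescaled a T) t x = T t x.
Proof.
by rewrite /rescaled scalerA -rmorphM -expRD mulNr addNr expR0 rmorph1 scale1r.
Qed.

Lemma rescaled_orbit_derivP (E : normedModType K) a (T : R -> E -> E) x y :
  semigroup s T ->
  orbit_deriv s (rescaled a T) x y <-> orbit_deriv s T x (y - a%:K *: x).
Proof.
move=> sgT; split=> hy; last first.
  have := rescaled_orbit_deriv a sgT hy.
  by rewrite subrK.
have := rescaled_orbit_deriv (- a) (rescaled_semigroup a sgT) hy.
rewrite rmorphN scaleNr => {}hy e /hy[d d0 hd].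
by exists d => // t /hd; rewrite rescaledK.
Qed.

(** The semigroup exp(-at)T(t) has the generator A - a, and at time 1 it is a
    strict contraction as soon as a is large. *)
Lemma large_resolvent_point (E : normedModType K) (T : R -> E -> E) :
  approx_complete s E -> semigroup s T ->
  exists a0, forall a, a0 <= a -> resolvent_point T a%:K.
Proof.
move=> cE sgT; have [M M1 hM] := sg_bound sgT 1.
exists (2 * M) => a aM; have sgTa := rescaled_semigroup (- a) sgT.
have [|surj [C C0 hC]] := contractive_resolvent_point cE sgTa.
  move=> x; rewrite /rescaled mulr1 nrmZr ?expR_ge0 //.
  have Tx : nm (T 1 x) <= M * nm x by rewrite hM ?ler01 ?lexx.
  have ea : expR (- a) * a <= 1.
    have := expR_ge1Dx a; have := expR_gt0 a => e0 h.
    by rewrite expRN mulrC ler_pdivrMr // mul1r; lra.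
  apply: le_trans (ler_wpM2l (expR_ge0 _) Tx) _.
  rewrite mulrA mulrC ler_wpM2l ?nrm_ge0 //.
  have := ler_wpM2l (expR_ge0 (- a)) aM; lra.
split=> [x|].
  have [y /(rescaled_orbit_derivP _ _ _ sgT) hy] := surj x; exists y.
  by move: hy; congr orbit_deriv; rewrite rmorphN; module_eq K.
exists C => // y w hy; have := hC y (w + (- a)%:K *: y).
rewrite (rescaled_orbit_derivP _ _ _ sgT) addrK => /(_ hy).
by rewrite scale0r sub0r opprD rmorphN scaleNr opprK [- w + _]addrC.
Qed.

End Resolvents.

(** * Resolvent sets and Favard classes *)

Section Operators.
Context (R : realType) (K : numFieldType) (s : scalars R K).
Local Notation "t %:K" := (of_real s t) (at level 2, format "t %:K").
Local Notation nm := (nrm s).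

Definition linear_op (E F : normedModType K) (G : operator E F) : Prop :=
  dom G 0 /\ forall a x y, dom G x -> dom G y ->
    dom G (a *: x + y) /\ G (a *: x + y) = a *: G x + G y.

Lemma resolvent_setP (E : normedModType K) (G : operator E E) (l : K) :
  linear_op G ->
  resolvent_set G l <->
  (forall x, exists2 y, dom G y & l *: y - G y = x) /\
  exists2 C : R, 0 <= C &
    forall y, dom G y -> nm y <= C * nm (l *: y - G y).
Proof.
move=> [G0 linG]; split=> [[[_ inj surj] /(bounded_opP s)[_ [C C0 hC]]]|].
  split=> [x|]; first by have [y Gy yx] := surj x I; exists y.
  exists C => [|y Gy]; first exact: ltW.
  apply: le_trans (hC _); rewrite /resolvent.
  case: xgetP => [y' _ [Gy' y'E]|/(_ y)/=[]//].
  suff -> : y = y' by [].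
  by apply: inj; rewrite ?inE // y'E.
move=> [surj [C C0 hC]].
have inj : set_inj (dom G) (op_shift l G).
  move=> y y'; rewrite !inE => Gy Gy' /= yy'.
  have [Gd Gdiff] := linG (-1) y' y Gy' Gy.
  apply/eqP; rewrite -subr_eq0; apply/eqP; apply: (nrm_eq0 (s := s)).
  apply/eqP; rewrite eq_le nrm_ge0 andbT.
  have := hC _ Gd; rewrite Gdiff (_ : l *: _ - _ = 0).
    by rewrite nrm0 mulr0 scaleN1r addrC.
  have -> : l *: (-1 *: y' + y) - (-1 *: G y' + G y) =
      (l *: y - G y) - (l *: y' - G y') by module_eq K.
  by rewrite yy' subrr.
have resE y : dom G y -> resolvent G l (l *: y - G y) = y.
  move=> Gy; rewrite /resolvent; case: xgetP => [y' _ [Gy' y'E]|/(_ y)/=[]//].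
  by apply: inj; rewrite ?inE.
split; first by split=> // x _; have [y Gy yx] := surj x; exists y.
apply/(bounded_opP s); split.
  move=> a x1 x2; have [y1 Gy1 <-] := surj x1; have [y2 Gy2 <-] := surj x2.
  have [Gy Gyl] := linG a y1 y2 Gy1 Gy2.
  have -> : a *: (l *: y1 - G y1) + (l *: y2 - G y2) =
      l *: (a *: y1 + y2) - G (a *: y1 + y2) by rewrite Gyl; module_eq K.
  by rewrite !resE.
exists (C + 1) => [|x]; first by lra.
have [y Gy <-] := surj x; rewrite resE //; apply: le_trans (hC y Gy) _.
by rewrite ler_wpM2r ?nrm_ge0 //; lra.
Qed.

Lemma generator_linear (E : normedModType K) (T : R -> E -> E) :
  semigroup s T -> linear_op (generator s T).
Proof.
move=> sgT; split; first by have /generatorP[] := orbit_deriv0 sgT.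
move=> a x y hx hy; have /generatorP Dx := conj hx (erefl (generator s T x)).
have /generatorP Dy := conj hy (erefl (generator s T y)).
by have /generatorP := orbit_deriv_linear sgT a Dx Dy.
Qed.

Lemma generator_resolventP (E : normedModType K) (T : R -> E -> E) l :
  semigroup s T ->
  resolvent_set (generator s T) l <-> resolvent_point s T l.
Proof.
move=> sgT; rewrite (resolvent_setP _ (generator_linear sgT)).
split=> -[surj [C C0 hC]]; split.
- move=> x; have [y Gy yx] := surj x; exists y; apply/generatorP.
  by split=> //; rewrite -yx opprB addrC subrK.
- by exists C => // y w /generatorP[Gy <-]; apply: hC.
- move=> x; have [y /generatorP[Gy yE]] := surj x; exists y => //.
  by rewrite yE opprB addrC subrK.
- by exists C => // y Gy; apply: hC; apply/generatorP.
Qed.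

Lemma diag_resolventP (E F : normedModType K) (T : R -> E -> E)
    (S : R -> F -> F) l : semigroup s T -> semigroup s S ->
  resolvent_set (op_diag (generator s T) (generator s S)) l <->
  resolvent_point s T l /\ resolvent_point s S l.
Proof.
move=> sgT sgS; have [T0 linT] := generator_linear sgT.
have [S0 linS] := generator_linear sgS.
have [G0T GS0] : generator s T 0 = 0 /\ generator s S 0 = 0.
  have /generatorP[_ ->] := orbit_deriv0 sgT.
  by have /generatorP[_ ->] := orbit_deriv0 sgS.
rewrite resolvent_setP; last first.
  split=> [//|a [x y] [x' y'] /= [Tx Sy] [Tx' Sy']].
  have [Dx Ex] := linT a x x' Tx Tx'; have [Dy Ey] := linS a y y' Sy Sy'.
  by split; [split | exact: (f_equal2 pair Ex Ey)].
have shiftE x y : l *: (x, y) - op_diag (generator s T) (generator s S) (x, y) =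
    (l *: x - generator s T x, l *: y - generator s S y) by [].
have GT : linear_op (generator s T) by apply: generator_linear.
have GS : linear_op (generator s S) by apply: generator_linear.
rewrite -!generator_resolventP // (resolvent_setP _ GT) (resolvent_setP _ GS).
split.
  move=> [surj [C C0 hC]]; split; (split; last exists C => //).
  - by move=> x; have [[y z] [Ty Sz] [yx _]] := surj (x, 0); exists y.
  - move=> y Ty; have := hC (y, 0) (conj Ty S0).
    rewrite shiftE !nrm_pair GS0 scaler0 subr0 nrm0.
    by rewrite !(max_idPl (nrm_ge0 s _)).
  - by move=> x; have [[y z] [Ty Sz] [_ yx]] := surj (0, x); exists z.
  - move=> y Ty; have := hC (0, y) (conj T0 Ty).
    rewrite shiftE !nrm_pair G0T scaler0 subr0 nrm0.
    by rewrite !(max_idPr (nrm_ge0 s _)).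
move=> [[surjT [C C0 hC]] [surjS [C' C'0 hC']]]; split.
  move=> [x y]; have [x' Tx' <-] := surjT x; have [y' Sy' <-] := surjS y.
  by exists (x', y').
exists (C + C') => [|[x y] /= [Tx Sy]]; first by lra.
rewrite shiftE !nrm_pair ge_max; set m := Num.max _ _.
have m0 : 0 <= m by rewrite le_max nrm_ge0.
have mx : nm (l *: x - generator s T x) <= m by rewrite le_max lexx.
have my : nm (l *: y - generator s S y) <= m by rewrite le_max lexx orbT.
have := mulr_ge0 C0 m0; have := mulr_ge0 C'0 m0.
have := ler_wpM2l C0 mx; have := ler_wpM2l C'0 my.
by have := hC x Tx; have := hC' y Sy => *; apply/andP; split; lra.
Qed.

(** The elements of L(F, Fav_1), with the supremum in the Favard norm spelled
    out. *)
Definition lipschitz_orbits (E F : normedModType K) (T : R -> E -> E)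
    (P : F -> E) : Prop :=
  linear P /\ exists2 C : R, 0 <= C & forall y, nm (P y) <= C * nm y /\
    forall t, 0 < t <= 1 -> nm (T t (P y) - P y) <= C * t * nm y.

Lemma bounded_to_favardP (E F : normedModType K) (T : R -> E -> E)
    (P : F -> E) :
  bounded_to_favard s T P <-> lipschitz_orbits T P.
Proof.
have q0 x : favard_quotients s T x !=set0.
  by exists (1^-1 * nm (T 1 x - x)), 1 => //=; rewrite in_itv /= ltr01 lexx.
split.
  move=> [linP favP [C hC]]; split=> //; exists `|C| => // y.
  have y0 := nrm_ge0 s y.
  have sup0 : 0 <= sup (favard_quotients s T (P y)).
    have [r qr] := q0 (P y); apply: le_trans (ub_le_sup (favP y) qr).
    case: qr => t; rewrite /= in_itv /= => /andP[t0 _] <-.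
    by rewrite mulr_ge0 ?invr_ge0 ?nrm_ge0 // ltW.
  have P0 := nrm_ge0 s (P y).
  have {}hC : favard_norm s T (P y) <= `|C| * nm y.
    by apply: le_trans (hC y) _; rewrite ler_wpM2r // ler_norm.
  rewrite /favard_norm in hC; split=> [|t t01]; first lra.
  have /andP[t0 _] := t01.
  rewrite mulrAC [leRHS]mulrC -ler_pdivrMl //.
  suff : t^-1 * nm (T t (P y) - P y) <= sup (favard_quotients s T (P y)) by lra.
  by apply: (ub_le_sup (favP y)); exists t => //=; rewrite in_itv.
move=> [linP [C C0 hC]].
have qC y : ubound (favard_quotients s T (P y)) (C * nm y).
  move=> _ [t /= + <-]; rewrite in_itv /= => t01; have /andP[t0 _] := t01.
  by rewrite ler_pdivrMl // mulrA [t * C]mulrC; have [_] := hC y; apply.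
split=> // [y|]; first by exists (C * nm y); apply: qC.
exists (2 * C) => y; rewrite /favard_norm.
have : sup (favard_quotients s T (P y)) <= C * nm y.
  by apply: ge_sup (q0 _) (qC y).
by have [] := hC y; lra.
Qed.

Lemma resolvent_function (E : normedModType K) (T : R -> E -> E) l :
  semigroup s T -> resolvent_point s T l -> exists Rl : E -> E,
  [/\ linear Rl,
      exists2 C : R, 0 <= C & forall x, nm (Rl x) <= C * nm x,
      forall x, orbit_deriv s T (Rl x) (l *: Rl x - x),
      forall y w, orbit_deriv s T y w -> Rl (l *: y - w) = y
    & forall t x, 0 <= t -> Rl (T t x) = T t (Rl x)].
Proof.
move=> sgT [/choice[Rl hR] [C C0 hC]]; exists Rl.
have inj y w : orbit_deriv s T y w -> Rl (l *: y - w) = y.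
  move=> hy; apply/eqP; rewrite -subr_eq0; apply/eqP.
  apply: (nrm_eq0 (s := s)); apply/eqP; rewrite eq_le nrm_ge0 andbT.
  apply: le_trans (hC _ _ (orbit_derivB sgT (hR (l *: y - w)) hy)) _.
  rewrite (_ : l *: _ - _ = 0) ?nrm0 ?mulr0 //.
  by module_eq K.
split=> //.
- move=> a x y; rewrite -[RHS](inj _ _ (orbit_deriv_linear sgT a (hR x) (hR y))).
  by congr Rl; module_eq K.
- exists C => // x; apply: le_trans (hC _ _ (hR x)) _.
  by rewrite opprB addrC subrK.
- move=> t x t0; rewrite -[RHS](inj _ _ (orbit_deriv_orbit sgT t0 (hR x))).
  have lt := sg_linear sgT t0; congr Rl.
  by rewrite (linB lt) (linZ lt); module_eq K.
Qed.

End Operators.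

(** * A mean value inequality *)

Section MeanValue.
Context (R : realType) (K : numFieldType) (s : scalars R K).
Local Notation nm := (nrm s).

(** Only difference quotients to the right are controlled, as this is what the
    semigroup law provides.  The set of times t at which the slightly weaker
    bound (c + e)t holds contains its supremum, by continuity from the left, and
    the supremum can only be b. *)
Lemma mean_value_right (E : normedModType K) (f : R -> E) (b c : R) : 0 <= b ->
  (forall t (e : R), 0 <= t < b -> 0 < e -> exists2 d : R, 0 < d &
     forall h, 0 < h <= d -> t + h <= b -> nm (f (t + h) - f t) <= (c + e) * h) ->
  (forall t (e : R), 0 < t <= b -> 0 < e -> exists2 d : R, 0 < d &
     forall r, 0 <= r <= t -> t - r <= d -> nm (f t - f r) <= e) ->
  nm (f b - f 0) <= c * b.
Proof.
move=> b0 hder hcont; apply: le_eps => e' e'0.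
pose e := e' / (b + 1); have e0 : 0 < e by rewrite divr_gt0 //; lra.
apply: (@le_trans _ _ ((c + e) * b)); last first.
  rewrite mulrDl lerD2l /e mulrAC ler_pdivrMr; last lra.
  by rewrite ler_wpM2l //; lra.
pose A := [set t : R | 0 <= t <= b /\ nm (f t - f 0) <= (c + e) * t].
have A0 : A 0 by split; rewrite ?lexx // subrr nrm0 mulr0.
have supA : has_sup A by split; [exists 0 | exists b => t [/andP[]]].
pose t := sup A.
have t0 : 0 <= t by apply: (ub_le_sup supA.2 A0).
have tb : t <= b by apply: ge_sup; [exists 0 | move=> r [/andP[]]].
have At : A t.
  split; first by rewrite t0.
  have [t00|t_neq0] := eqVneq t 0; first by rewrite t00 subrr nrm0 mulr0.
  have tgt0 : 0 < t by rewrite lt_def t_neq0.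
  apply: le_eps => z z0; have [||d d0 hd] := hcont t (z / 2); [by rewrite tgt0|lra|].
  pose k := Num.min d (z / (2 * (`|c + e| + 1))).
  have k0 : 0 < k.
    by rewrite lt_min d0 divr_gt0 // mulr_gt0 //; have := normr_ge0 (c + e); lra.
  have [r [/andP[r0 rb] hr] tr] := sup_adherent k0 supA.
  have rt : r <= t by apply: (ub_le_sup supA.2); split; rewrite ?r0.
  have trk : t - r <= k by rewrite -/t in tr; lra.
  have p1 : nm (f t - f r) <= z / 2.
    by apply: hd; [rewrite r0|apply: le_trans trk _; rewrite ge_min lexx].
  have p2 : (c + e) * r <= (c + e) * t + z / 2.
    rewrite -lerBlDl -mulrBr; apply: le_trans (ler_norm _) _.
    rewrite normrM distrC (ger0_norm (_ : 0 <= t - r)); last lra.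
    have h1 := normr_ge0 (c + e).
    have h2 : t - r <= z / (2 * (`|c + e| + 1)).
      by apply: le_trans trk _; rewrite ge_min lexx orbT.
    apply: le_trans (ler_wpM2l h1 h2) _.
    rewrite (_ : `|c + e| * _ = z / 2 * (`|c + e| / (`|c + e| + 1))); last first.
      by field; rewrite gt_eqF //; lra.
    by rewrite ler_piMr ?ler_pdivrMr //; lra.
  have : nm (f t - f 0) <= z / 2 + (c + e) * r.
    by apply: nrm_le2 p1 hr _; module_eq K.
  by move: p2; lra.
have [tltb|] := ltP t b; last first.
  move=> bt; have tbE : t = b by apply/eqP; rewrite eq_le tb.
  by rewrite -[X in f X - _]tbE -[X in _ * X]tbE; exact: At.2.
exfalso; have [||d d0 hd] := hder t e; [by rewrite t0|by []|].
pose h := Num.min d (b - t).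
have h0 : 0 < h by rewrite lt_min d0 subr_gt0.
have hb : t + h <= b by rewrite addrC -lerBrDr ge_min lexx orbT.
have Ath : A (t + h).
  split; first by rewrite hb andbT; lra.
  have dh : 0 < h <= d by rewrite h0 ge_min lexx.
  have -> : (c + e) * (t + h) = (c + e) * h + (c + e) * t by ring.
  have [_ fA] := At; have fh : nm (f (t + h) - f t) <= (c + e) * h := hd h dh hb.
  by apply: nrm_le2 fh fA _; module_eq K.
have : t + h <= t by apply: (ub_le_sup supA.2).
lra.
Qed.

End MeanValue.

(** * Triangular semigroups *)

Section Triangular.
Context (R : realType) (K : numFieldType) (s : scalars R K).
Context (E F : normedModType K) (calT : R -> E * F -> E * F).
Context (T : R -> E -> E) (Rt : R -> F -> E) (S : R -> F -> F).
Hypothesis cE : approx_complete s E.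
Hypothesis cF : approx_complete s F.
Hypothesis sgC : semigroup s calT.
Hypothesis Tlin : forall t, 0 <= t -> linear (T t).
Hypothesis Rlin : forall t, 0 <= t -> linear (Rt t).
Hypothesis Slin : forall t, 0 <= t -> linear (S t).
Hypothesis calTE : forall t, 0 <= t ->
  forall x y, calT t (x, y) = (T t x + Rt t y, S t y).

Local Notation "t %:K" := (of_real s t) (at level 2, format "t %:K").
Local Notation nm := (nrm s).

Lemma calT_fst t x : 0 <= t -> calT t (x, 0) = (T t x, 0).
Proof.
by move=> t0; rewrite calTE // (lin0 (Rlin t0)) (lin0 (Slin t0)) addr0.
Qed.

Lemma calT_snd t y : 0 <= t -> calT t (0, y) = (Rt t y, S t y).
Proof. by move=> t0; rewrite calTE // (lin0 (Tlin t0)) add0r. Qed.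

Lemma triangular_bound L : exists2 M : R, 1 <= M & forall t, 0 <= t <= L ->
  [/\ forall x, nm (T t x) <= M * nm x, forall y, nm (Rt t y) <= M * nm y
    & forall y, nm (S t y) <= M * nm y].
Proof.
have [M M1 hM] := sg_bound sgC L; exists M => // t tL; have /andP[t0 _] := tL.
split=> [x|y|y].
- have := hM t (x, 0) tL; rewrite calT_fst // !nrm_pair nrm0.
  by rewrite !(max_idPl (nrm_ge0 s _)).
- have := hM t (0, y) tL; rewrite calT_snd // !nrm_pair nrm0.
  by rewrite !(max_idPr (nrm_ge0 s _)) ge_max => /andP[].
- have := hM t (0, y) tL; rewrite calT_snd // !nrm_pair nrm0.
  by rewrite !(max_idPr (nrm_ge0 s _)) ge_max => /andP[].
Qed.

Lemma corner_semigroup : semigroup s T.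
Proof.
split=> //.
- by move=> x; have := sg_0 sgC (x, 0); rewrite calT_fst // => -[].
- move=> t r t0 r0 x; have := sg_D sgC t0 r0 (x, 0).
  by rewrite !calT_fst ?addr_ge0 // => -[].
- move=> x e e0; have [d d0 hd] := sg_cont0 sgC (x, 0) e0.
  exists d => // t td; have /andP[t0 _] := td.
  have := hd t td; rewrite calT_fst //.
  rewrite (_ : (T t x, 0) - (x, 0) = (T t x - x, 0 - 0)) // nrm_pair ge_max.
  by case/andP.
- move=> L; have [M M1 hM] := triangular_bound L.
  by exists M => // t x /hM[].
Qed.

Lemma diagonal_semigroup : semigroup s S.
Proof.
split=> //.
- by move=> y; have := sg_0 sgC (0, y); rewrite calT_snd // => -[].
- move=> t r t0 r0 y; have := sg_D sgC t0 r0 (0, y).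
  by rewrite !calT_snd ?addr_ge0 // calTE // => -[].
- move=> y e e0; have [d d0 hd] := sg_cont0 sgC (0, y) e0.
  exists d => // t td; have /andP[t0 _] := td.
  have := hd t td; rewrite calT_snd //.
  rewrite (_ : (Rt t y, S t y) - (0, y) = (Rt t y - 0, S t y - y)) //.
  by rewrite nrm_pair ge_max => /andP[].
- move=> L; have [M M1 hM] := triangular_bound L.
  by exists M => // t y /hM[].
Qed.

Let sgT := corner_semigroup.
Let sgS := diagonal_semigroup.

Lemma Rt_D t r y : 0 <= t -> 0 <= r ->
  Rt (t + r) y = T t (Rt r y) + Rt t (S r y).
Proof.
move=> t0 r0; have := sg_D sgC t0 r0 (0, y).
by rewrite !calT_snd ?addr_ge0 // calTE // => -[].
Qed.

Lemma Rt_0 y : Rt 0 y = 0.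
Proof. by have := sg_0 sgC (0, y); rewrite calT_snd // => -[]. Qed.

Lemma Rt_cont0 y (e : R) : 0 < e -> exists2 d : R, 0 < d &
  forall t, 0 <= t <= d -> nm (Rt t y) <= e.
Proof.
move=> e0; have [d d0 hd] := sg_cont0 sgC (0, y) e0.
exists d => // t td; have /andP[t0 _] := td.
have := hd t td; rewrite calT_snd //.
rewrite (_ : (Rt t y, S t y) - (0, y) = (Rt t y - 0, S t y - y)) //.
by rewrite nrm_pair ge_max subr0 => /andP[].
Qed.

Lemma calT_derivP x y u v : orbit_deriv s calT (x, y) (u, v) <->
  (forall e : R, 0 < e -> exists2 d, 0 < d & forall t, 0 < t <= d ->
    nm (T t x + Rt t y - x - t%:K *: u) <= e * t) /\ orbit_deriv s S y v.
Proof.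
have qE t : 0 <= t -> nm (calT t (x, y) - (x, y) - t%:K *: (u, v)) =
    Num.max (nm (T t x + Rt t y - x - t%:K *: u)) (nm (S t y - y - t%:K *: v)).
  by move=> t0; rewrite calTE // -nrm_pair.
split=> [hC|[hT hS] e e0].
  split=> e e0; have [d d0 hd] := hC e e0; exists d => // t td;
    have /andP[/ltW t0 _] := td; have := hd t td;
    by rewrite qE // ge_max => /andP[].
have [d d0 hd] := hT e e0; have [d' d'0 hd'] := hS e e0.
exists (Num.min d d') => [|t]; first by rewrite lt_min d0.
rewrite le_min => /and3P[t0 td td'].
by rewrite qE ?(ltW t0) // ge_max hd ?t0 // hd' ?t0.
Qed.

Lemma calT_deriv_fst x u :
  orbit_deriv s calT (x, 0) (u, 0) <-> orbit_deriv s T x u.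
Proof.
rewrite calT_derivP; split=> [[hT _] e /hT[d d0 hd]|hT].
  exists d => // t td; have /andP[/ltW t0 _] := td.
  by have := hd t td; rewrite (lin0 (Rlin t0)) addr0.
split; last exact: orbit_deriv0 sgS.
move=> e /hT[d d0 hd]; exists d => // t td; have /andP[/ltW t0 _] := td.
by rewrite (lin0 (Rlin t0)) addr0; apply: hd.
Qed.

Definition corner_lipschitz := exists M : R, 0 < M /\
  forall t, 0 <= t <= 1 -> forall y, nm (Rt t y) <= M * t * nm y.

(** The operator identity l - calA = (l - D)(1, -D_l; 0, 1) in terms of the
    graphs of the generators: writing calA(x, y) = (u, v), the first component
    of the right-hand side is (l - A)(x - D_l y) = lx - u. *)
Definition factors (l : K) (D : F -> E) := forall x y u v,
  orbit_deriv s calT (x, y) (u, v) <->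
  orbit_deriv s T (x - D y) (u - l *: D y) /\ orbit_deriv s S y v.

(** For y in the domain of B, the pair (Dy, y) lies in the domain of the whole
    generator, with image (l Dy, By).  As T(h)Dy - Dy is of order h by the Favard
    estimate, so is R(h)y, with a constant depending on the norm of y only.
    This bound holds for each y separately; it is integrated along
    s |-> T(b - s)R(s)y, which runs from 0 to R(b)y and whose increments are
    T(b - s - h)R(h)S(s)y.  Density of the domain of B finishes the proof. *)
Lemma factors_corner_lipschitz l D :
  lipschitz_orbits s T D -> factors l D -> corner_lipschitz.
Proof.
move=> [Dlin [C C0 hC]] fac; have [M M1 hM] := triangular_bound 1.
have M0 : 0 <= M by lra.
have l0 := absK_ge0 s l.
pose B := absK s l * C + C; have B0 : 0 <= B by rewrite addr_ge0 // mulr_ge0.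
have small y v (e : R) : orbit_deriv s S y v -> 0 < e ->
    exists2 d : R, 0 < d & forall h, 0 < h <= d ->
      nm (Rt h y) <= (B * nm y + e) * h.
  move=> hy e0; have /calT_derivP[+ _] : orbit_deriv s calT (D y, y) (l *: D y, v).
    by apply/fac; rewrite !subrr; split=> //; apply: orbit_deriv0 sgT.
  move=> /(_ e e0)[d d0 hd]; exists (Num.min 1 d); first by rewrite lt_min d0 ltr01.
  move=> h; rewrite le_min => /and3P[h0 h1 hd']; have [Dy TDy] := hC y.
  have p1 : nm (T h (D y) + Rt h y - D y - h%:K *: (l *: D y)) <= e * h.
    by rewrite hd ?h0.
  have p2 : nm (T h (D y) - D y) <= C * h * nm y by rewrite TDy ?h0.
  have p3 : nm (h%:K *: (l *: D y)) <= h * (absK s l * (C * nm y)).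
    by rewrite nrmZr ?(ltW h0) // nrmZ ler_wpM2l ?(ltW h0) // ler_wpM2l.
  have -> : (B * nm y + e) * h = e * h + (h * (absK s l * (C * nm y)) + C * h * nm y).
    by rewrite /B; ring.
  by apply: nrm_le2 p1 (nrm_le2B p3 p2 erefl) _; module_eq K.
have main y v b : orbit_deriv s S y v -> 0 <= b <= 1 ->
    nm (Rt b y) <= M * (B * (M * nm y)) * b.
  move=> hy /andP[b0 b1].
  pose f t := T (b - t) (Rt t y).
  have -> : Rt b y = f b - f 0.
    by rewrite /f Rt_0 subrr (sg_0 sgT) subr0 (lin0 (Tlin b0)) subr0.
  apply: mean_value_right => // t e.
    move=> /andP[t0 tb] e0.
    have Sty : nm (S t y) <= M * nm y.
      by have [|_ _] := hM t; [rewrite t0; lra | apply].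
    have [||d d0 hd] := small (S t y) (S t v) (e / M).
    - exact: orbit_deriv_orbit.
    - by rewrite divr_gt0 //; lra.
    exists d => // h hd' thb; have /andP[h0 _] := hd'.
    have bth : 0 <= b - (t + h) by lra.
    have -> : f (t + h) - f t = T (b - (t + h)) (Rt h (S t y)).
      have bE : T (b - t) (Rt t y) = T (b - (t + h)) (T h (Rt t y)).
        by rewrite -(sg_D sgT bth (ltW h0)); congr (T _ _); ring.
      rewrite /f bE addrC [t + h]addrC Rt_D ?(ltW h0) // [h + t]addrC.
      by rewrite (linD (Tlin bth)) addKr.
    have [|hT _ _] := hM (b - (t + h)); first by rewrite bth; lra.
    apply: le_trans (hT _) _; apply: le_trans (ler_wpM2l M0 (hd h hd')) _.
    rewrite [leLHS]mulrA ler_wpM2r ?(ltW h0) // mulrDr.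
    rewrite [M * (e / M)]mulrC divfK; last by rewrite gt_eqF //; lra.
    by rewrite lerD2r ler_wpM2l // ler_wpM2l.
  move=> /andP[t0 tb] e0; have t0' := ltW t0.
  have MM : 0 < 2 * (M * M) by rewrite !mulr_gt0 //; lra.
  have [|d d0 hd] := Rt_cont0 (S t y) (e := e / (2 * (M * M))).
    by rewrite divr_gt0.
  have [|d' d'0 hd'] := sg_cont0 sgS y (e := e / (2 * (M * (M * M)))).
    by rewrite divr_gt0 // !mulr_gt0 //; lra.
  exists (Num.min d d'); first by rewrite lt_min d0.
  move=> r /andP[r0 rt]; rewrite le_min => /andP[trd trd'].
  have tr0 : 0 <= t - r by lra.
  have bt : 0 <= b - t by lra.
  have -> : f t - f r = T (b - t) (Rt (t - r) (S r y)).
    have bE : T (b - r) (Rt r y) = T (b - t) (T (t - r) (Rt r y)).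
      by rewrite -(sg_D sgT bt tr0); congr (T _ _); ring.
    have tE : Rt t y = T (t - r) (Rt r y) + Rt (t - r) (S r y).
      by rewrite -Rt_D // subrK.
    by rewrite /f bE tE (linD (Tlin bt)) [LHS]addrC addKr.
  have [|hT _ _] := hM (b - t); first by apply/andP; split; lra.
  have [|_ hR _] := hM (t - r); first by apply/andP; split; lra.
  have [|_ _ hS] := hM r; first by apply/andP; split; lra.
  apply: le_trans (hT _) _; rewrite -ler_pdivlMl; last by lra.
  have p1 : nm (Rt (t - r) (S t y)) <= e / (2 * (M * M)).
    by apply: hd; rewrite tr0.
  have p2 : nm (Rt (t - r) (S r (S (t - r) y - y))) <= M * (M * (e / (2 * (M * (M * M))))).
    apply: le_trans (hR _) _; rewrite ler_wpM2l //.
    by apply: le_trans (hS _) _; rewrite ler_wpM2l // hd' // tr0.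
  have Mn0 : M != 0 by rewrite gt_eqF //; lra.
  apply: (@le_trans _ _ (e / (2 * (M * M)) + M * (M * (e / (2 * (M * (M * M))))))).
    apply: nrm_le2B p1 p2 _.
    rewrite (linB (Slin r0)) (linB (Rlin tr0)) -(sg_D sgS) // subrKC.
    by module_eq K.
  rewrite (_ : _ + _ = M^-1 * e * ((M + 1) / (2 * M)));
    last by field; rewrite Mn0.
  rewrite ler_piMr ?ler_pdivrMr //; [|lra|lra].
  by rewrite mulr_ge0 ?invr_ge0 // ltW.
exists (M * (B * M) + 1); split; first by have := mulr_ge0 M0 (mulr_ge0 B0 M0); lra.
move=> t t01 y; have /andP[t0 t1] := t01; apply: le_eps => e e0.
have [|y' [v [hy' yy']]] := orbit_deriv_dense sgS y (e := e / (M * (B * M) + M)) cF.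
  by rewrite divr_gt0 //; have := mulr_ge0 M0 (mulr_ge0 B0 M0); lra.
have p1 := main y' v t hy' t01.
have [_ hR _] := hM t t01; have p2 := hR (y - y').
have y'n := nrmD s y (y' - y); rewrite subrKC in y'n.
have G0 := mulr_ge0 M0 (mulr_ge0 B0 M0).
rewrite (_ : M * (B * (M * nm y')) * t = M * (B * M) * t * nm y') in p1; last by ring.
have Gt0 : 0 <= M * (B * M) * t by rewrite mulr_ge0.
have p3 := ler_wpM2l Gt0 y'n.
have h4 : M * (B * M) * t * nm (y' - y) <= M * (B * M) * nm (y' - y).
  by rewrite ler_wpM2r ?nrm_ge0 // ler_piMr.
have h5 : (M * (B * M) + M) * nm (y' - y) <= e.
  by rewrite -ler_pdivlMl ?[_^-1 * e]mulrC //; lra.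
have h6 : 0 <= t * nm y by rewrite mulr_ge0 ?nrm_ge0.
have := nrmD s (Rt t (y - y')) (Rt t y').
rewrite -(linD (Rlin t0)) subrK (nrmBC s y) in p2 * => h7.
by lra.
Qed.

(** The operator sought is Dy = lim R(l, A)R(h)y / h as h tends to 0, that is
    R(l, A_{-1})P.  For y in the domain of B, the generator of the triangular
    semigroup determines a vector d with calA(d, y) = (ld, By), and applying
    R(l, A) to T(h)d + R(h)y = d + hld + o(h) shows that d is this limit.  The
    Lipschitz bound on R makes the approximations uniformly bounded in y, so the
    limit exists everywhere by density.  It takes values in the Favard class
    because R(l, A) maps vectors R(h)y / h, which stay bounded, into the domain
    of A with a bounded image under A. *)
Lemma corner_lipschitz_factors l : corner_lipschitz -> resolvent_point s T l ->
  exists D, lipschitz_orbits s T D /\ factors l D.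
Proof.
move=> [M [M0 hM]] hl.
have [Rl [Rlin' [C C0 hC] Rder Rinj Rcomm]] := resolvent_function sgT hl.
(* Over every point of the domain of B there is a point of the domain of the
   whole generator, since both have a resolvent point in common. *)
have lift y v : orbit_deriv s S y v ->
    exists x u, orbit_deriv s calT (x, y) (u, v).
  move=> hy.
  have [a0 ha] := large_resolvent_point (approx_complete_prod cE cF) sgC.
  have [a1 ha1] := large_resolvent_point cF sgS.
  pose m := (Num.max a0 a1)%:K.
  have [surj _] : resolvent_point s calT m by apply: ha; rewrite le_max lexx.
  have hm : resolvent_point s S m by apply: ha1; rewrite le_max lexx orbT.
  have [Rm [_ _ _ Rminj _]] := resolvent_function sgS hm.
  have [[x y'] hx] := surj (0, m *: y - v).
  have hy' : orbit_deriv s S y' (m *: y' - (m *: y - v)).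
    by have /calT_derivP[] := hx.
  have yE : y' = y.
    rewrite -(Rminj _ _ hy') -[RHS](Rminj _ _ hy); congr Rm.
    by module_eq K.
  exists x, (m *: x - 0); rewrite -{1}yE.
  rewrite (_ : v = m *: y' - (m *: y - v)) //.
  by rewrite yE; module_eq K.
(* A correction by R(l, A) in the first component makes the image under the
   generator equal to ld there. *)
have special y v : orbit_deriv s S y v ->
    exists d, orbit_deriv s calT (d, y) (l *: d, v).
  move=> /lift[x [u hx]]; exists (x - Rl (l *: x - u)).
  have /calT_deriv_fst hR := Rder (l *: x - u).
  have := orbit_derivB sgC hx hR.
  rewrite (_ : (x, y) - (_, 0) = (x - Rl (l *: x - u), y - 0)) //.
  rewrite (_ : (u, v) - (_, 0) =
    (u - (l *: Rl (l *: x - u) - (l *: x - u)), v - 0)) //.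
  rewrite !subr0; congr (orbit_deriv _ _ _ (_, _)).
  by module_eq K.
pose lim_at y d := forall e : R, 0 < e -> exists2 h0 : R, 0 < h0 &
  forall h, 0 < h <= h0 -> nm (Rl (Rt h y) - h%:K *: d) <= e * h.
have special_lim y v d : orbit_deriv s calT (d, y) (l *: d, v) -> lim_at y d.
  move=> /calT_derivP[hd _] e e0.
  have [|h1 h10 hd1] := hd (e / (2 * (C + 1))); first by rewrite divr_gt0 //; lra.
  have [|h2 h20 hd2] := Rder d (e / 2); first lra.
  exists (Num.min h1 h2); first by rewrite lt_min h10.
  move=> h; rewrite le_min => /and3P[h0 hh1 hh2].
  have {}hd1 : nm (T h d + Rt h y - d - h%:K *: (l *: d)) <= e / (2 * (C + 1)) * h.
    by rewrite hd1 ?h0.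
  have {}hd2 : nm (T h (Rl d) - Rl d - h%:K *: (l *: Rl d - d)) <= e / 2 * h.
    by rewrite hd2 ?h0.
  have p1 : nm (Rl (T h d + Rt h y - d - h%:K *: (l *: d))) <= e / 2 * h.
    apply: le_trans (hC _) _; apply: le_trans (ler_wpM2l C0 hd1) _.
    rewrite (_ : C * _ = e / 2 * h * (C / (C + 1))); last first.
      by field; rewrite gt_eqF //; lra.
    by rewrite ler_piMr ?ler_pdivrMr ?mulr_ge0 ?(ltW h0) //; lra.
  rewrite (_ : e * h = e / 2 * h + e / 2 * h); last by lra.
  apply: nrm_le2B p1 hd2 _.
  rewrite !(linB Rlin') (linD Rlin') !(linZ Rlin') Rcomm ?(ltW h0) //.
  by module_eq K.
have lim_diff y y' d d' : lim_at y d -> lim_at y' d' ->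
    nm (d - d') <= C * M * nm (y - y').
  move=> hd hd'; apply: le_eps => e e0.
  have [|h1 h10 hd1] := hd (e / 2); first lra.
  have [|h2 h20 hd2] := hd' (e / 2); first lra.
  pose h := Num.min 1 (Num.min h1 h2).
  have h0 : 0 < h by rewrite !lt_min h10 ltr01.
  have p1 : nm (Rl (Rt h y) - h%:K *: d) <= e / 2 * h.
    by apply: hd1; rewrite h0 !ge_min lexx orbT.
  have p2 : nm (Rl (Rt h y') - h%:K *: d') <= e / 2 * h.
    by apply: hd2; rewrite h0 !ge_min lexx !orbT.
  have p3 : nm (Rl (Rt h (y - y'))) <= C * (M * h * nm (y - y')).
    apply: le_trans (hC _) _; rewrite ler_wpM2l // hM //.
    by rewrite (ltW h0) !ge_min lexx.
  rewrite -(ler_pM2l h0) -nrmZr ?(ltW h0) //.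
  rewrite (_ : h * _ = C * (M * h * nm (y - y')) + (e / 2 * h + e / 2 * h));
    last by lra.
  apply: nrm_le2B p3 (nrm_le2B p1 p2 erefl) _.
  by rewrite (linB (Rlin (ltW h0))) (linB Rlin'); module_eq K.
have CM0 : 0 <= C * M by rewrite mulr_ge0 // ltW.
have lim_ex y : exists d, lim_at y d.
  have [||d hd] := @cE (fun e d => exists y', [/\ lim_at y' d,
      nm (y' - y) <= e & C * M * nm (y' - y) <= e]).
  - move=> e e0; have [|y' [v [hy' yy']]] :=
      orbit_deriv_dense sgS y (e := Num.min e (e / (C * M + 1))) cF.
      by rewrite lt_min e0 divr_gt0 //; lra.
    move: yy'; rewrite le_min => /andP[yy' yy''].
    have [d hd] := special _ _ hy'; exists d, y'; split=> //.
      exact: special_lim hd.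
    have := nrm_ge0 s (y' - y).
    by move: yy''; rewrite ler_pdivlMr; lra.
  - move=> e e' d d' e0 e'0 [y1 [h1 _ hy1]] [y2 [h2 _ hy2]].
    apply: le_trans (lim_diff _ _ _ _ h1 h2) _.
    have y12 : nm (y1 - y2) <= nm (y1 - y) + nm (y2 - y).
      by apply: nrm_le2B (lexx _) (lexx _) _; module_eq K.
    by have := ler_wpM2l CM0 y12; lra.
  exists d => e e0.
  have [|y' [v [hy' yy']]] :=
      orbit_deriv_dense sgS y (e := e / (3 * (C * M + 1))) cF.
    by rewrite divr_gt0 //; lra.
  have [d' /special_lim hd'] := special _ _ hy'.
  have CMy : C * M * nm (y' - y) <= e / 3.
    apply: le_trans (ler_wpM2l CM0 yy') _.
    rewrite (_ : C * M * _ = e / 3 * (C * M / (C * M + 1))); last first.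
      by field; rewrite gt_eqF //; lra.
    by rewrite ler_piMr ?ler_pdivrMr //; lra.
  have dd' : nm (d' - d) <= e / 3.
    apply: hd; first lra.
    exists y'; split=> //; apply: le_trans yy' _.
    by rewrite ler_pdivrMr ?ler_pdivlMr; nra.
  have [|h1 h10 hd1] := hd' (e / 3); first lra.
  exists (Num.min 1 h1); first by rewrite lt_min h10 ltr01.
  move=> h; rewrite le_min => /and3P[h0 hh1 hh].
  have p1 : nm (Rl (Rt h y') - h%:K *: d') <= e / 3 * h by rewrite hd1 ?h0.
  have p2 : nm (Rl (Rt h (y' - y))) <= e / 3 * h.
    apply: le_trans (hC _) _.
    have Ry : nm (Rt h (y' - y)) <= M * h * nm (y' - y) by rewrite hM ?(ltW h0).
    apply: le_trans (ler_wpM2l C0 Ry) _.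
    rewrite (_ : C * _ = C * M * nm (y' - y) * h); last by ring.
    by rewrite ler_wpM2r // ltW.
  have p3 : nm (h%:K *: (d' - d)) <= e / 3 * h.
    by rewrite nrmZr ?(ltW h0) // mulrC ler_wpM2r // ltW.
  rewrite (_ : e * h = e / 3 * h + e / 3 * h + e / 3 * h); last by lra.
  apply: nrm_le2 (nrm_le2B p1 p2 erefl) p3 _.
  by rewrite (linB (Rlin (ltW h0))) (linB Rlin'); module_eq K.
have lim_unique y d d' : lim_at y d -> lim_at y d' -> d = d'.
  move=> hd hd'; apply/eqP; rewrite -subr_eq0; apply/eqP.
  apply: (nrm_eq0 (s := s)); apply/eqP; rewrite eq_le nrm_ge0 andbT.
  by have := lim_diff _ _ _ _ hd hd'; rewrite subrr nrm0 mulr0.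
have lim_linear a y1 y2 d1 d2 : lim_at y1 d1 -> lim_at y2 d2 ->
    lim_at (a *: y1 + y2) (a *: d1 + d2).
  move=> hd1 hd2 e e0; have a0 := absK_ge0 s a.
  have [|h1 h10 hh1] := hd1 (e / (2 * (absK s a + 1))).
    by apply: divr_gt0 => //; lra.
  have [|h2 h20 hh2] := hd2 (e / 2); first lra.
  exists (Num.min h1 h2); first by rewrite lt_min h10.
  move=> h; rewrite le_min => /and3P[h0 hhh1 hhh2].
  have p1 : nm (a *: (Rl (Rt h y1) - h%:K *: d1)) <= e / 2 * h.
    have p : nm (Rl (Rt h y1) - h%:K *: d1) <= e / (2 * (absK s a + 1)) * h.
      by rewrite hh1 ?h0.
    rewrite nrmZ; apply: le_trans (ler_wpM2l a0 p) _.
    rewrite (_ : absK s a * _ = e / 2 * h * (absK s a / (absK s a + 1)));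
      last by field; rewrite gt_eqF //; lra.
    by rewrite ler_piMr ?ler_pdivrMr ?mulr_ge0 ?(ltW h0) //; lra.
  have p2 : nm (Rl (Rt h y2) - h%:K *: d2) <= e / 2 * h by rewrite hh2 ?h0.
  rewrite (_ : e * h = e / 2 * h + e / 2 * h); last by lra.
  apply: nrm_le2 p1 p2 _.
  rewrite (Rlin (ltW h0)) (linD Rlin') (linZ Rlin').
  by module_eq K.
have [D hD] := choice lim_ex.
have D_deriv y v : orbit_deriv s S y v ->
    orbit_deriv s calT (D y, y) (l *: D y, v).
  move=> /special[d hd]; have -> // : D y = d.
  exact: lim_unique (hD y) (special_lim _ _ _ hd).
exists D; split.
  split.
    by move=> a y1 y2; apply: lim_unique (hD _) (lim_linear _ _ _ _ _ (hD _) (hD _)).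
  have [N N1 hN] := sg_bound sgT 1; have N0 : 0 <= N by lra.
  have l0 := absK_ge0 s l.
  pose C' := N * (absK s l * C + 1) * M.
  have lC1 : 0 <= absK s l * C + 1 by rewrite addr_ge0 // mulr_ge0.
  have C'0 : 0 <= C' by rewrite mulr_ge0 ?(ltW M0) // mulr_ge0.
  exists (C * M + C') => [|y]; first by lra.
  have y0 := nrm_ge0 s y.
  split.
    have lim00 : lim_at 0 0.
      by have := lim_linear (-1) y y _ _ (hD y) (hD y); rewrite !scaleN1r !addNr.
    have := lim_diff _ _ _ _ (hD y) lim00; rewrite !subr0.
    by have := mulr_ge0 C'0 y0; lra.
  move=> t /andP[t0 t1].
  suff : nm (T t (D y) - D y) <= C' * t * nm y.
    by have := mulr_ge0 (mulr_ge0 CM0 (ltW t0)) y0; lra.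
  apply: le_eps => e e0.
  have [|h1 h10 hh1] := hD y (e / (N + 1)); first by rewrite divr_gt0 //; lra.
  pose h := Num.min 1 h1; have h0 : 0 < h by rewrite lt_min ltr01.
  have p1 : nm (Rl (Rt h y) - h%:K *: D y) <= e / (N + 1) * h.
    by apply: hh1; rewrite h0 ge_min lexx orbT.
  have Ry : nm (Rt h y) <= M * h * nm y.
    by apply: hM; rewrite (ltW h0) ge_min lexx.
  have t01 : 0 <= t <= 1 by rewrite (ltW t0).
  have p2 : nm (T t (Rl (Rt h y) - h%:K *: D y)) <= N * (e / (N + 1) * h).
    by apply: le_trans (hN _ _ t01) _; rewrite ler_wpM2l.
  have p3 : nm (T t (Rl (Rt h y)) - Rl (Rt h y)) <=
      t * (N * ((absK s l * C + 1) * (M * h * nm y))).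
    apply: le_trans (orbit_lipschitz sgT cE t0 N0 _ (Rder (Rt h y))) _.
      move=> r x /andP[r0 rt]; apply: hN; rewrite r0; lra.
    rewrite ler_wpM2l ?(ltW t0) // ler_wpM2l //.
    apply: (@le_trans _ _ ((absK s l * C + 1) * nm (Rt h y))); last first.
      by rewrite ler_wpM2l.
    rewrite mulrDl mul1r; apply: nrm_le2B _ (lexx _) erefl.
    by rewrite nrmZ -mulrA ler_wpM2l.
  rewrite -(ler_pM2l h0) -[leLHS]nrmZr ?(ltW h0) //.
  rewrite (_ : h * (_ + _) = t * (N * ((absK s l * C + 1) * (M * h * nm y))) +
    (N * (e / (N + 1) * h) + e / (N + 1) * h)); last first.
    by rewrite /C'; field; rewrite gt_eqF //; lra.
  apply: nrm_le2B p3 (nrm_le2B p2 p1 erefl) _.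
  have lt := Tlin (ltW t0).
  by rewrite (linB lt) (linZ lt); module_eq K.
move=> x y u v; split=> [hx|[hx hy]].
  have hy : orbit_deriv s S y v by have /calT_derivP[] := hx.
  split=> //; apply/calT_deriv_fst.
  have := orbit_derivB sgC hx (D_deriv _ _ hy).
  rewrite (_ : (x, y) - _ = (x - D y, y - y)) //.
  by rewrite (_ : (u, v) - _ = (u - l *: D y, v - v)) // !subrr.
have /calT_deriv_fst hx' := hx.
have := orbit_derivD sgC hx' (D_deriv _ _ hy).
rewrite (_ : (_, 0) + (D y, y) = (x - D y + D y, 0 + y)) //.
rewrite (_ : (_, 0) + (l *: D y, v) = (u - l *: D y + l *: D y, 0 + v)) //.
by rewrite !subrK !add0r.
Qed.

End Triangular.

(** * The extrapolation space *)

Section Extrapolation.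
Context (R : realType) (K : numFieldType) (s : scalars R K).
Context (E : normedModType K) (T : R -> E -> E).
Hypothesis cE : approx_complete s E.
Hypothesis sgT : semigroup s T.
Variable XE : extrapolation s T.
Local Notation "t %:K" := (of_real s t) (at level 2, format "t %:K").
Local Notation nm := (nrm s).
Local Notation mu := (ext_mu XE).
Local Notation X := (ext_space XE).
Local Notation emb := (ext_emb XE).

Lemma ext_mu_point : resolvent_point s T mu.
Proof. by apply/generator_resolventP => //; apply: ext_muP. Qed.

(** The map R(mu, A)x |-> x, from the domain of A into E_{-1}, is isometric by
    definition of the extrapolated norm.  Its domain and its range are dense, so
    it extends to an isometry k of E onto E_{-1}, which is mu - A_{-1}.  Thus
    (T_{-1}(t)) is a copy of (T(t)), and everything about E_{-1} can be computed
    in E.  The graph of k is the closure of the pairs (R(mu, A)x, x), called rel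
    below. *)
Lemma ext_iso_exists : exists2 k : E -> X,
  [/\ linear k, forall x, nm (k x) = nm x, forall z, exists x, k x = z
    & forall t x, 0 <= t -> ext_sg XE t (k x) = k (T t x)] &
  forall x w, emb x = k w <-> orbit_deriv s T w (mu *: w - x).
Proof.
have [Rl [Rlin [C C0 hC] Rder Rinj Rcomm]] :=
  resolvent_function sgT ext_mu_point.
have resE x : resolvent (generator s T) mu x = Rl x.
  have /generatorP[RD RE] := Rder x; rewrite /resolvent.
  case: xgetP => [y _ [yD yE]|/(_ (Rl x))]; last first.
    move=> []; split=> //.
    rewrite -[LHS]/(mu *: Rl x - generator s T (Rl x)) RE.
    by rewrite opprB addrC subrK.
  have /Rinj <- : orbit_deriv s T y (generator s T y) by apply/generatorP.
  by rewrite -[in RHS]yE.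
have embn x : nm (emb x) = nm (Rl x) by rewrite /nrm ext_norm resE.
have embB x y : emb (x - y) = emb x - emb y by rewrite linearB.
pose rel e z := forall h : R, 0 < h -> exists x,
  nm (Rl x - e) <= h /\ nm (emb x - z) <= h.
have rel_le e z e' z' : rel e z -> rel e' z' -> nm (z - z') <= nm (e - e').
  move=> hz hz'; apply: le_eps => h h0; have h40 : 0 < h / 4 by lra.
  have [x [x1 x2]] := hz _ h40; have [x' [x'1 x'2]] := hz' _ h40.
  have p : nm (emb (x - x')) <= nm (e - e') + (h / 4 + h / 4).
    rewrite embn (linB Rlin).
    by apply: nrm_le2 (lexx _) (nrm_le2B x1 x'1 erefl) _; module_eq K.
  have -> : nm (e - e') + h = nm (e - e') + (h / 4 + h / 4) + (h / 4 + h / 4).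
    by lra.
  by apply: nrm_le2B p (nrm_le2B x2 x'2 erefl) _; rewrite embB; module_eq K.
have rel_ge e z e' z' : rel e z -> rel e' z' -> nm (e - e') <= nm (z - z').
  move=> hz hz'; apply: le_eps => h h0; have h40 : 0 < h / 4 by lra.
  have [x [x1 x2]] := hz _ h40; have [x' [x'1 x'2]] := hz' _ h40.
  have p : nm (Rl (x - x')) <= nm (z - z') + (h / 4 + h / 4).
    rewrite -embn embB.
    by apply: nrm_le2 (lexx _) (nrm_le2B x2 x'2 erefl) _; module_eq K.
  have -> : nm (z - z') + h = nm (z - z') + (h / 4 + h / 4) + (h / 4 + h / 4).
    by lra.
  by apply: nrm_le2B p (nrm_le2B x1 x'1 erefl) _; rewrite (linB Rlin); module_eq K.
have rel_fun e z z' : rel e z -> rel e z' -> z = z'.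
  move=> h h'; apply/eqP; rewrite -subr_eq0; apply/eqP.
  apply: (nrm_eq0 (s := s)); apply/eqP; rewrite eq_le nrm_ge0 andbT.
  by have := rel_le _ _ _ _ h h'; rewrite subrr nrm0.
have rel_R x : rel (Rl x) (emb x).
  by move=> h h0; exists x; rewrite !subrr !nrm0 ltW.
have rel_linear a e z e' z' : rel e z -> rel e' z' ->
    rel (a *: e + e') (a *: z + z').
  move=> hz hz' h h0; have a0 := absK_ge0 s a.
  have [|x [x1 x2]] := hz (h / (2 * (absK s a + 1))).
    by apply: divr_gt0 => //; lra.
  have [|x' [x'1 x'2]] := hz' (h / 2); first lra.
  have ah : absK s a * (h / (2 * (absK s a + 1))) <= h / 2.
    rewrite (_ : absK s a * _ = h / 2 * (absK s a / (absK s a + 1)));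
      last by field; rewrite gt_eqF //; lra.
    by rewrite ler_piMr ?ler_pdivrMr //; lra.
  have scale (V : normedModType K) (v : V) :
      nm v <= h / (2 * (absK s a + 1)) -> nm (a *: v) <= h / 2.
    by move=> hv; rewrite nrmZ; apply: le_trans (ler_wpM2l a0 hv) ah.
  exists (a *: x + x'); rewrite (_ : h = h / 2 + h / 2); last by lra.
  split; [apply: nrm_le2 (scale _ _ x1) x'1 _ | apply: nrm_le2 (scale _ _ x2) x'2 _].
    by rewrite (linD Rlin) (linZ Rlin); module_eq K.
  by rewrite (linearP emb) /=; module_eq K.
have rel_total e : exists z, rel e z.
  have cX : approx_complete s X by apply: complete_approx.
  have [||z hz] := cX (fun h z => exists2 x, z = emb x & nm (Rl x - e) <= h).
  - move=> h h0; have [x' [y' [hx' xe]]] := orbit_deriv_dense sgT e cE h0.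
    by exists (emb (mu *: x' - y')), (mu *: x' - y') => //; rewrite (Rinj _ _ hx').
  - move=> h h' _ _ h0 h'0 [x -> hx] [x' -> hx'].
    by rewrite -embB embn (linB Rlin); apply: nrm_le2B hx hx' _; module_eq K.
  exists z => h h0; have [x' [y' [hx' xe]]] := orbit_deriv_dense sgT e cE h0.
  exists (mu *: x' - y'); rewrite (Rinj _ _ hx'); split=> //.
  by apply: hz => //; exists (mu *: x' - y') => //; rewrite (Rinj _ _ hx').
have dense_emb z (h : R) : 0 < h -> exists x, nm (emb x - z) <= h.
  move=> h0; pose B := [set w : X | nm (w - z) < h].
  have [||w [/interior_subset Bw [x _ xw]]] := @ext_dense _ _ _ _ _ XE (B°).
  - by exists z; apply/(nbhs_nrmP s); exists h.
  - exact: open_interior.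
  by exists x; rewrite xw ltW.
have rel_surj z : exists e, rel e z.
  have [||e he] := @cE (fun h e => exists2 x, e = Rl x & nm (emb x - z) <= h).
  - by move=> h h0; have [x hx] := dense_emb z h h0; exists (Rl x), x.
  - move=> h h' _ _ h0 h'0 [x -> hx] [x' -> hx'].
    by rewrite -(linB Rlin) -embn embB; apply: nrm_le2B hx hx' _; module_eq K.
  exists e => h h0; have [x hx] := dense_emb z h h0; exists x; split=> //.
  by apply: he => //; exists x.
have [k hk] := choice rel_total; exists k; first split.
- by move=> a x y; apply: rel_fun (hk _) (rel_linear _ _ _ _ _ (hk x) (hk y)).
- have rel0 : rel 0 0.
    have := rel_linear (-1) _ _ _ _ (hk 0) (hk 0).
    by rewrite !scaleN1r !addNr.
  move=> x; apply/eqP; rewrite eq_le.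
  have := rel_le _ _ _ _ (hk x) rel0; have := rel_ge _ _ _ _ (hk x) rel0.
  by rewrite !subr0 => -> ->.
- move=> z; have [e he] := rel_surj z; exists e.
  exact: rel_fun (hk e) he.
- move=> t x t0; apply/esym/(rel_fun _ _ _ (hk _)) => h h0.
  have [M M1 hM] := sg_bound sgT t; have Mp : 0 < M by lra.
  have /(cvg_nrmP s) /(_ h h0) /(nbhs_nrmP s)[d d0 hd] :=
    @ext_sg_continuous _ _ _ _ _ XE t t0 (k x).
  have m0 : 0 < Num.min (d / 2) (h / M) by rewrite lt_min !divr_gt0.
  have [y []] := hk x _ m0; rewrite !le_min => /andP[_ y1] /andP[y2 _].
  exists (T t y); split.
    rewrite Rcomm // -(linB (sg_linear sgT t0)).
    apply: le_trans (hM _ _ _) _; first by rewrite t0 lexx.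
    by rewrite -ler_pdivlMl // [M^-1 * h]mulrC.
  rewrite -ext_sgE //; apply/ltW/hd; apply: le_lt_trans y2 _; lra.
- move=> x w; split=> [xw|hw]; last first.
    rewrite -(Rinj _ _ hw) (_ : mu *: w - _ = x); last by module_eq K.
    exact: rel_fun (rel_R x) (hk _).
  have -> // : w = Rl x.
  apply/eqP; rewrite -subr_eq0; apply/eqP; apply: (nrm_eq0 (s := s)).
  apply/eqP; rewrite eq_le nrm_ge0 andbT.
  have := rel_ge _ _ _ _ (hk w) (rel_R x).
  by rewrite xw subrr nrm0.
Qed.

End Extrapolation.

(** * The operator identities *)

Section OperatorForms.
Context (R : realType) (K : numFieldType) (s : scalars R K).
Context (E F : normedModType K) (calT : R -> E * F -> E * F).
Context (T : R -> E -> E) (S : R -> F -> F).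
Local Notation nm := (nrm s).
Local Notation calA := (generator s calT).
Local Notation calD := (op_diag (generator s T) (generator s S)).

Definition graph (U V : Type) (G : operator U V) (x : U) (y : V) : Prop :=
  dom G x /\ G x = y.

Lemma op_eqP (U V : Type) (G H : operator U V) :
  op_eq G H <-> forall x y, graph G x y <-> graph H x y.
Proof.
split=> [[domE valE] x y|GH].
  by rewrite /graph -domE; split=> -[Gx <-]; rewrite valE.
have valE x : dom G x -> graph H x (G x) by move=> Gx; apply/GH.
split=> [|x /valE[]//]; apply/seteqP; split=> x; first by move=> /valE[].
by move=> Hx; have /GH[] : graph H x (H x).
Qed.

Lemma graph_op_part (U : choiceType) (W : Type) (j : U -> W)
    (G : operator U W) x y : injective j ->
  graph (op_part j G) x y <-> graph G x (j y).
Proof.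
move=> injj; rewrite /graph /=; split.
  by move=> [[Gx [w _ jw]] <-]; split=> //; case: xgetP => // /(_ w).
move=> [Gx Gy]; split; first by split=> //; exists y.
by case: xgetP => [w _ jw|/(_ y)[]//]; apply: injj; rewrite -Gy.
Qed.

Lemma factorized_formP l :
  factorized_form s calA calD T l <->
  exists D, lipschitz_orbits s T D /\ factors s calT T S l D.
Proof.
suff facP (D : F -> E) : op_eq (op_shift l calA)
      (op_comp (op_shift l calD)
         (op_total (fun z : E * F => (z.1 - D z.2, z.2)))) <->
    factors s calT T S l D.
  split=> -[D [favD h]]; exists D; split.
  - exact/bounded_to_favardP.
  - exact/facP.
  - exact/bounded_to_favardP.
  - exact/facP.
have shiftP z w : graph (op_shift l calA) z w <->
    orbit_deriv s calT z (l *: z - w).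
  rewrite -generatorP; split=> -[Az zw]; split=> //.
    by rewrite -zw subKr.
  by rewrite -[LHS]/(l *: z - calA z) zw subKr.
have diagP x y u v : graph (op_comp (op_shift l calD)
      (op_total (fun z : E * F => (z.1 - D z.2, z.2)))) (x, y) (u, v) <->
    orbit_deriv s T (x - D y) (l *: (x - D y) - u) /\
    orbit_deriv s S y (l *: y - v).
  rewrite -!generatorP; split.
    move=> [[_ [Ax By]] xy].
    have [<- <-] : l *: (x - D y) - generator s T (x - D y) = u /\
        l *: y - generator s S y = v by case: xy => <- <-.
    by rewrite !subKr.
  move=> [[Ax xu] [By yv]]; split=> //.
  transitivity (l *: (x - D y) - generator s T (x - D y),
                l *: y - generator s S y) => //.
  by rewrite xu yv !subKr.
rewrite op_eqP; split=> [h x y u v|fac [x y] [u v]].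
  have := h (x, y) (l *: x - u, l *: y - v).
  rewrite shiftP diagP.
  rewrite (_ : l *: (x, y) - _ = (l *: x - (l *: x - u), l *: y - (l *: y - v))) //.
  rewrite !subKr.
  by rewrite (_ : l *: (x - D y) - _ = u - l *: D y) //; module_eq K.
rewrite shiftP diagP.
rewrite (_ : l *: (x, y) - _ = (l *: x - u, l *: y - v)) // fac.
by rewrite (_ : l *: x - u - _ = l *: (x - D y) - u) //; module_eq K.
Qed.

(** Since mu - A_{-1} is an isometry k of E onto E_{-1} which maps Fav_1(A) onto
    Fav_0(A), the operators P in L(F, Fav_0(A)) are exactly the k D with D in
    L(F, Fav_1(A)).  The equation A_{-1}x + Py = u in E_{-1} then becomes
    mu x - u = k(x - Dy), which says that x - Dy = R(mu, A)(mu x - u). *)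
Lemma extrapolated_formP (XE : extrapolation s T) (XF : extrapolation s S) :
  approx_complete s E -> approx_complete s F ->
  semigroup s T -> semigroup s S ->
  extrapolated_form calA XE XF <->
  exists D, lipschitz_orbits s T D /\ factors s calT T S (ext_mu XE) D.
Proof.
move=> cE cF sgT sgS.
have [k [klin kn ksurj kT] kmu] := ext_iso_exists cE sgT XE.
have [k' [k'lin k'n k'surj k'T] k'mu] := ext_iso_exists cF sgS XF.
have iso_deriv (V : normedModType K) (Q : R -> V -> V) (XQ : extrapolation s Q)
    (q : V -> ext_space XQ) : linear q -> (forall x, nm (q x) = nm x) ->
    (forall t x, 0 <= t -> ext_sg XQ t (q x) = q (Q t x)) -> forall x y,
    orbit_deriv s (ext_sg XQ) (q x) (q y) <-> orbit_deriv s Q x y.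
  move=> qlin qn qQ x y; split=> h e /h[d d0 hd]; exists d => // t td;
    have := hd t td; have /andP[/ltW t0 _] := td;
    by rewrite qQ // -!(linZ qlin) -!(linB qlin) qn.
have iso_inj (V W : normedModType K) (q : V -> W) : linear q ->
    (forall x, nm (q x) = nm x) -> injective q.
  move=> qlin qn x y xy; apply/eqP; rewrite -subr_eq0; apply/eqP.
  by apply: (nrm_eq0 (s := s)); rewrite -qn (linB qlin) xy subrr nrm0.
have kinj := iso_inj _ _ k klin kn; have k'inj := iso_inj _ _ k' k'lin k'n.
have mu_inj (V : normedModType K) (Q : R -> V -> V) (XQ : extrapolation s Q)
    (q : V -> ext_space XQ) : semigroup s Q -> (forall z, exists x, q x = z) ->
    (forall x w, ext_emb XQ x = q w <->
       orbit_deriv s Q w (ext_mu XQ *: w - x)) -> injective (ext_emb XQ).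
  move=> sgQ qsurj qmu x y xy; have [w hw] := qsurj (ext_emb XQ x).
  have hx : orbit_deriv s Q w (ext_mu XQ *: w - x) by apply/qmu.
  have hy : orbit_deriv s Q w (ext_mu XQ *: w - y) by apply/qmu; rewrite -xy.
  by have /addrI/oppr_inj := orbit_deriv_unique hx hy.
have einj := mu_inj _ _ XE k sgT ksurj kmu.
have e'inj := mu_inj _ _ XF k' sgS k'surj k'mu.
(* On the image of E, A_{-1} is mu - k. *)
have emb_deriv (V : normedModType K) (Q : R -> V -> V) (XQ : extrapolation s Q)
    (q : V -> ext_space XQ) : semigroup s Q -> linear q ->
    (forall x, nm (q x) = nm x) -> (forall z, exists x, q x = z) ->
    (forall t x, 0 <= t -> ext_sg XQ t (q x) = q (Q t x)) ->
    (forall x w, ext_emb XQ x = q w <->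
       orbit_deriv s Q w (ext_mu XQ *: w - x)) -> forall x,
    orbit_deriv s (ext_sg XQ) (ext_emb XQ x) (ext_mu XQ *: ext_emb XQ x - q x).
  move=> sgQ qlin qn qsurj qQ qmu x; have [w hw] := qsurj (ext_emb XQ x).
  have /esym/qmu hx := hw; rewrite -hw -(linZ qlin) -(linB qlin).
  exact/iso_deriv.
have Pder x := emb_deriv _ _ XE k sgT klin kn ksurj kT kmu x.
have P'der y := emb_deriv _ _ XF k' sgS k'lin k'n k'surj k'T k'mu y.
have partP (P : F -> ext_space XE) x y u v :
    graph (perturbed_part XF P) (x, y) (u, v) <->
    ext_mu XE *: ext_emb XE x - k x + P y = ext_emb XE u /\
    ext_mu XF *: ext_emb XF y - k' y = ext_emb XF v.
  rewrite graph_op_part; last by move=> [a b] [c d] [/einj-> /e'inj->].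
  have /generatorP[D1 E1] := Pder x; have /generatorP[D2 E2] := P'der y.
  rewrite -E1 -E2; split; first by move=> [_ [<- <-]]; rewrite addr0.
  move=> [h1 h2]; split; first by split.
  transitivity (generator s (ext_sg XE) (ext_emb XE x) + P y,
                generator s (ext_sg XF) (ext_emb XF y) + 0) => //.
  by rewrite h1 addr0 h2.
have key (D : F -> E) : op_eq calA (perturbed_part XF (k \o D)) <->
    factors s calT T S (ext_mu XE) D.
  suff graphP x y u v : graph (perturbed_part XF (k \o D)) (x, y) (u, v) <->
      orbit_deriv s T (x - D y) (u - ext_mu XE *: D y) /\ orbit_deriv s S y v.
    rewrite op_eqP; split=> [h x y u v|fac [x y] [u v]].
      by rewrite -generatorP -graphP; apply: h.
    by rewrite graphP -fac -generatorP.
  have fstP : ext_mu XE *: ext_emb XE x - k x + k (D y) = ext_emb XE u <->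
      orbit_deriv s T (x - D y) (u - ext_mu XE *: D y).
    have := kmu (ext_mu XE *: x - u) (x - D y).
    rewrite (_ : ext_mu XE *: (x - D y) - _ = u - ext_mu XE *: D y);
      last by module_eq K.
    move=> <-; rewrite linearB linearZ /= (linB klin) -addrA (addrC (- k x)).
    rewrite -(opprB (k x)); split=> [<-|h]; first by rewrite subKr.
    by rewrite -h subKr.
  have sndP : ext_mu XF *: ext_emb XF y - k' y = ext_emb XF v <->
      orbit_deriv s S y v.
    have := k'mu (ext_mu XF *: y - v) y; rewrite subKr => <-.
    by rewrite linearB linearZ /=; split=> [<-|<-]; rewrite subKr.
  by rewrite partP fstP sndP.
have favP (D : F -> E) :
    lipschitz_orbits s (ext_sg XE) (k \o D) <-> lipschitz_orbits s T D.
  split=> -[Dlin [C C0 hC]]; (split; last exists C => // y).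
  - move=> a x y; apply: kinj; have := Dlin a x y.
    by rewrite /= klin.
  - have [h1 h2] := hC y; rewrite /= kn in h1; split=> // t t01.
    have /andP[/ltW t0 _] := t01.
    by have := h2 t t01; rewrite /= kT // -(linB klin) kn.
  - by move=> a x y; rewrite /= Dlin klin.
  - have [h1 h2] := hC y; rewrite /= kn; split=> // t t01.
    have /andP[/ltW t0 _] := t01.
    by rewrite /= kT // -(linB klin) kn; apply: h2.
split=> [[P [/bounded_to_favardP favPP PE]]|[D [favD fac]]].
  have [D hD] := choice (fun y => ksurj (P y)).
  have PD : P = k \o D by apply/funext => y /=; rewrite hD.
  exists D; rewrite PD in favPP PE; split; [exact/favP | exact/key].
exists (k \o D); split; [apply/bounded_to_favardP; exact/favP | exact/key].
Qed.

End OperatorForms.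

(** * The equivalence of the assertions *)

Lemma semigroup_growth (R : realType) (K : numFieldType) (s : scalars R K)
    (E : normedModType K) (T : R -> E -> E) : semigroup s T ->
  exists M w : R, [/\ 1 <= M, 0 <= w & forall t x, 0 <= t ->
    nrm s (T t x) <= M * expR (w * t) * nrm s x].
Proof.
move=> sgT; have [M M1 hM] := sg_bound sgT 1; have M0 : 0 < M by lra.
exists M, (ln M); have lnM : 0 <= ln M by rewrite ln_ge0.
split=> // t x t0.
have pow n y : nrm s (T n%:R y) <= M ^+ n * nrm s y.
  elim: n y => [|n IH] y; first by rewrite (sg_0 sgT) mul1r.
  rewrite -natr1 (sg_D sgT) //; apply: le_trans (IH _) _.
  by rewrite exprSr -mulrA ler_wpM2l ?exprn_ge0 ?(ltW M0) // hM // ler01 lexx.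
pose n := Num.truncn t; have /andP[nt tn] := truncn_itv t0.
have -> : T t x = T n%:R (T (t - n%:R) x).
  by rewrite -(sg_D sgT) ?subr_ge0 // addrC subrK.
apply: le_trans (pow _ _) _.
have h1 : nrm s (T (t - n%:R) x) <= M * nrm s x.
  by apply: hM; rewrite subr_ge0 nt /=; move: tn; rewrite -natr1; lra.
apply: le_trans (ler_wpM2l (exprn_ge0 n (ltW M0)) h1) _.
rewrite mulrA ler_wpM2r ?nrm_ge0 // mulrC ler_wpM2l ?(ltW M0) //.
rewrite -{1}(lnK (M0 : M \is Num.pos)) -expRM_natl ler_expR mulrC.
by rewrite ler_wpM2l.
Qed.

Theorem proposition2p6 (R : realType) (K : numFieldType) (s : scalars R K)
    (E F : completeNormedModType K)
    (calT : R -> E * F -> E * F)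
    (T : R -> E -> E) (Rt : R -> F -> E) (S : R -> F -> F)
    (calT_sg : C0_semigroup calT)
    (T_op : forall t, 0 <= t -> bounded_op (T t))
    (Rt_op : forall t, 0 <= t -> bounded_op (Rt t))
    (S_op : forall t, 0 <= t -> bounded_op (S t))
    (calT_triangular : forall t, 0 <= t ->
       forall x y, calT t (x, y) = (T t x + Rt t y, S t y)) :
  let calA := generator s calT in
  let D := op_diag (generator s T) (generator s S) in
  let a := exists M : R, 0 < M /\
    forall t, 0 <= t <= 1 -> opnorm s (Rt t) <= M * t in
  let a' := exists M omega : R, 0 < M /\
    forall t, 0 <= t -> opnorm s (Rt t) <= M * t * expR (omega * t) in
  let b (XE : extrapolation s T) (XF : extrapolation s S) :=
    extrapolated_form calA XE XF in
  let c_some := exists lambda, resolvent_set D lambda /\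
    factorized_form s calA D T lambda in
  let c_all := forall lambda, resolvent_set D lambda ->
    factorized_form s calA D T lambda in
  [/\ a <-> a',
      forall (XE : extrapolation s T) (XF : extrapolation s S), a <-> b XE XF,
      a <-> c_some
    & a <-> c_all].
Proof.
move=> calA D a a' b c_some c_all.
have cE : approx_complete s E by apply: complete_approx.
have cF : approx_complete s F by apply: complete_approx.
have sgC := C0_semigroupP (approx_complete_prod cE cF) calT_sg.
have Tlin t (t0 : 0 <= t) : linear (T t) by have [] := T_op t t0.
have Rlin t (t0 : 0 <= t) : linear (Rt t) by have [] := Rt_op t t0.
have Slin t (t0 : 0 <= t) : linear (S t) by have [] := S_op t t0.
have sgT := corner_semigroup sgC Tlin Rlin Slin calT_triangular.
have sgS := diagonal_semigroup sgC Tlin Rlin Slin calT_triangular.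
have aP : a <-> corner_lipschitz s Rt.
  split=> -[M [M0 hM]]; exists M; split=> // t t01; have /andP[t0 _] := t01.
    apply/opnorm_leP; [exact: Rt_op | | exact: hM].
    by rewrite mulr_ge0 // ltW.
  by apply/opnorm_leP; [exact: Rt_op | rewrite mulr_ge0 // ltW | exact: hM].
have fac_l l : resolvent_point s T l -> a <->
    exists Dl, lipschitz_orbits s T Dl /\ factors s calT T S l Dl.
  move=> hl; rewrite aP; split=> [hR|[Dl [favDl fac]]].
    exact: corner_lipschitz_factors cE cF sgC Tlin Rlin Slin calT_triangular l hR hl.
  exact: (factors_corner_lipschitz cF sgC Tlin Rlin Slin calT_triangular favDl fac).
have cP l : resolvent_set D l -> a <-> factorized_form s calA D T l.
  by move=> /(diag_resolventP _ sgT sgS)[hl _]; rewrite factorized_formP; apply: fac_l.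
have [l hl] : exists l, resolvent_set D l.
  have [a0 ha0] := large_resolvent_point cE sgT.
  have [a1 ha1] := large_resolvent_point cF sgS.
  exists (of_real s (Num.max a0 a1)); apply/(diag_resolventP _ sgT sgS).
  by split; [apply: ha0; rewrite le_max lexx
            | apply: ha1; rewrite le_max lexx orbT].
split.
- split=> [ha|[M [w [M0 hM]]]]; last first.
    exists (M * expR `|w|); split; first by rewrite mulr_gt0 // expR_gt0.
    move=> t /andP[t0 t1]; apply: le_trans (hM t t0) _.
    rewrite mulrAC ler_wpM2r // ler_wpM2l ?(ltW M0) // ler_expR.
    apply: le_trans (ler_norm _) _; rewrite normrM (ger0_norm t0).
    by rewrite ler_piMr.
  have [M [w [M1 w0 hM]]] := semigroup_growth sgC.
  have [M' [M'0 hM']] := ha.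
  exists (M' + M), w; split=> [|t t0]; first by lra.
  have et : 1 <= expR (w * t) by rewrite -expR0 ler_expR mulr_ge0.
  have M't : 0 <= M' * t by rewrite mulr_ge0 // ltW.
  have Mt : 0 <= M * t by rewrite mulr_ge0 //; lra.
  have [t1|t1] := leP t 1.
    apply: le_trans (hM' t _) _; first by rewrite t0.
    apply: le_trans (_ : (M' + M) * t * 1 <= _); first by lra.
    by rewrite ler_wpM2l //; lra.
  have e0 := expR_ge0 (w * t).
  apply/opnorm_leP; [exact: Rt_op | by rewrite mulr_ge0 //; lra | move=> y].
  have := hM t (0, y) t0; rewrite calT_triangular // !nrm_pair.
  rewrite (lin0 (Tlin t t0)) add0r nrm0 (max_idPr (nrm_ge0 s y)) ge_max.
  move=> /andP[+ _] => /le_trans; apply; rewrite ler_wpM2r ?nrm_ge0 //.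
  rewrite ler_wpM2r //; have : M * 1 <= M * t by rewrite ler_wpM2l //; lra.
  by lra.
- move=> XE XF; rewrite /b extrapolated_formP //.
  exact/fac_l/ext_mu_point.
- split=> [ha|[l' [hl' h]]]; last exact/(cP l' hl').
  by exists l; split=> //; apply/(cP l hl).
- split=> [ha l' hl'|h]; first exact/(cP l' hl').
  by apply/(cP l hl); apply: h.
Qed.
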